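(* Let $q>1$. Then for every $0<\kappa_1<\kappa_2$ there exists a non-radial solution $u$ to $$\Delta^2 u+u^{-q}=0\quad\text{in }\mathbb{R}^3,\qquad u>0,$$ such that $$\liminf_{|x|\to\infty}\frac{u(x)}{|x|^2}=\kappa_1\quad\text{and}\quad\limsup_{|x|\to\infty}\frac{u(x)}{|x|^2}=\kappa_2.$$
   Context: $\Delta^2=\Delta\Delta$ is the bi-Laplacian on $\mathbb{R}^3$. A solution is an entire positive classical solution, i.e. a function $u\in C^4(\mathbb{R}^3)$ with $u>0$ satisfying the equation pointwise on all of $\mathbb{R}^3$. Non-radial means not radially symmetric (about any point of $\mathbb{R}^3$). *)

(* Defs.v *)
From HB Require Import structures.
From mathcomp Require Import all_boot all_order all_algebra.
From mathcomp Require Import all_classical all_reals all_analysis.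
Set Implicit Arguments.
Unset Strict Implicit.
Unset Printing Implicit Defensive.
Import Order.TTheory GRing.Theory Num.Theory.
Import numFieldNormedType.Exports.
Local Open Scope classical_set_scope.
Local Open Scope ring_scope.

(* The norm `|x| of the normed module 'rV[R]_n is the sup norm. It induces the
   usual topology and directional derivatives, but |x| in R^n is enorm x. *)
Definition enorm (R : realType) (n : nat) (x : 'rV[R]_n) : R :=
  Num.sqrt (\sum_(i < n) x 0 i ^+ 2).

Definition partial (R : realType) (n : nat) (i : 'I_n) (f : 'rV[R]_n -> R) :
    'rV[R]_n -> R :=
  fun x => 'D_(delta_mx 0 i) f x.

Fixpoint C_k (R : realType) (n k : nat) (f : 'rV[R]_n -> R) : Prop :=
  if k is k'.+1 then
    continuous f /\
    forall i : 'I_n,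
      (forall x, derivable f x (delta_mx 0 i)) /\ C_k k' (partial i f)
  else continuous f.

Definition laplacian (R : realType) (n : nat) (f : 'rV[R]_n -> R) :
    'rV[R]_n -> R :=
  fun x => \sum_(i < n) partial i (partial i f) x.

Definition bilaplacian (R : realType) (n : nat) (f : 'rV[R]_n -> R) :
    'rV[R]_n -> R :=
  laplacian (laplacian f).

Definition entire_positive_solution (R : realType) (q : R)
    (u : 'rV[R]_3 -> R) : Prop :=
  [/\ C_k 4 u,
      forall x, 0 < u x &
      forall x, bilaplacian u x + u x `^ (- q) = 0].

Definition radial_about (R : realType) (n : nat) (x0 : 'rV[R]_n)
    (u : 'rV[R]_n -> R) : Prop :=
  forall x y, enorm (x - x0) = enorm (y - x0) -> u x = u y.

Definition nonradial (R : realType) (n : nat) (u : 'rV[R]_n -> R) : Prop :=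
  ~ exists x0, radial_about x0 u.

Definition enorm_infty (R : realType) (n : nat) : set_system 'rV[R]_n :=
  filter_from [set: R] (fun M => [set x | M < enorm x]).
Arguments enorm_infty {R} n.

#[global] Instance enorm_infty_proper (R : realType) (n : nat) :
  ProperFilter (@enorm_infty R n.+1).
Proof.
apply: filter_from_proper; last first.
  move=> M _; exists (const_mx (`|M| + 1)) => /=; rewrite /enorm.
  have M1 : 0 <= `|M| + 1 by rewrite addr_ge0.
  apply: (@lt_le_trans _ _ (`|M| + 1)).
    by rewrite (le_lt_trans (ler_norm M))// ltrDl.
  rewrite -[leLHS](ger0_norm M1) -sqrtr_sqr ler_sqrt ?sumr_ge0//; last first.
    by move=> i _; exact: sqr_ge0.
  rewrite big_ord_recl mxE lerDl sumr_ge0// => i _; exact: sqr_ge0.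
apply: filter_from_filter; first by exists 0.
move=> M N _ _; exists (Num.max M N) => // x /=.
by rewrite gt_max => /andP[].
Qed.

(* Main.v *)
Require Import Defs.
From HB Require Import structures.
From mathcomp Require Import all_boot all_order all_algebra.
From mathcomp Require Import all_classical all_reals all_analysis.
From mathcomp Require Import measurable_realfun metric_structure.
From mathcomp Require Import ring lra.
Import Order.TTheory GRing.Theory Num.Theory.
Import numFieldNormedType.Exports.
Local Open Scope classical_set_scope.
Local Open Scope ring_scope.
Set Implicit Arguments.
Unset Strict Implicit.
Unset Printing Implicit Defensive.

(** The norm [N] of R^3 is, up to the factor [- 8 * pi], a fundamental solution
    of the bilaplacian, so the equation is solved by
      [u = C + Q + c * potential (u ^ (-q))],
    where [Q] is a positive definite quadratic form, which is biharmonic, and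
    [potential f x] is the integral of [taylor_kernel x y * f y]. The kernel is
    [N (x - y)] minus its first-order Taylor polynomial in [x] at the origin.
    Subtracting an affine function of [x] does not affect the equation, and it
    improves the kernel in two ways: by convexity of the norm it is nonnegative,
    and it is at most [2 * (1 + N x ^ 2) / (1 + N y)]. As [u] is then bounded
    below by [C + Q], which grows quadratically, the density [u ^ (-q)] is
    [O (N y ^ (-2 q))] and the potential converges for every [q > 1], although
    the density itself is integrable only for [q > 3/2].

    Existence is a fixed point problem for a map that is a contraction for the
    norm weighted by [C + Q] once [C] is large ([potential_fixed_point],
    [contraction_constant]).

    The potential is [o (N x ^ 2)] by dominated convergence, so [u] is asymptotic
    to [Q] ([solution_near_quadratic]). With [Q] equal to [kappa1] on one axis and
    to [kappa2] on the two others, the ratio of [u] to [N ^ 2] has the announced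
    lower and upper limits, and the different growth along two axes through a
    point excludes radial symmetry about it.

    The regularity involves bounded kernels only. Differentiating once replaces
    the kernel by differences of [unit_field], the gradient of the norm; every
    further derivative is put on the density. A density with [k]
    derivatives thus gives a potential with [k + 1], and the density has as many
    derivatives as [u] ([growth_partial_solution]). The derivatives of the density
    are integrable, so these are convolutions; passing from the first derivative,
    where the density itself still occurs, to the second requires a cancellation
    at infinity ([integral3_increment]).

    Finally the fourth derivatives of the potential that make up the bilaplacian
    are convolutions of [unit_field] with third derivatives of the density. The
    norm is replaced by [sqrt (eps ^ 2 + N ^ 2)], whose bilaplacian is
    [- 15 * eps ^ 4 * (eps ^ 2 + N ^ 2) ^ (- 7/2)]: integrating by parts moves all
    derivatives to this smooth kernel, whose total mass does not depend on [eps]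
    and concentrates at the origin ([smooth_bilaplacian], [bilaplacian_kernel]). *)

(** * The Euclidean norm *)

Section euclidean_norm.
Context {R : realType} {n : nat}.
Implicit Types (x y z : 'rV[R]_n) (i : 'I_n).
Local Notation N := (@enorm R n).

Lemma enorm_ge0 x : 0 <= N x. Proof. exact: sqrtr_ge0. Qed.

Lemma enorm_sqr x : N x ^+ 2 = \sum_(i < n) x 0 i ^+ 2.
Proof. by rewrite sqr_sqrtr// sumr_ge0// => i _; rewrite sqr_ge0. Qed.

Lemma enormN x : N (- x) = N x.
Proof. by congr Num.sqrt; apply: eq_bigr => i _; rewrite mxE sqrrN. Qed.

Lemma enormB x y : N (x - y) = N (y - x).
Proof. by rewrite -enormN opprB. Qed.

Lemma enorm0 : N 0 = 0.
Proof.
by rewrite /enorm big1 ?sqrtr0// => i _; rewrite mxE expr0n.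
Qed.

Lemma enormZ (t : R) x : N (t *: x) = `|t| * N x.
Proof.
rewrite -sqrtr_sqr -sqrtrM ?sqr_ge0// mulr_sumr; congr Num.sqrt.
by apply: eq_bigr => i _; rewrite mxE exprMn.
Qed.

Lemma coord_le_enorm x i : `|x 0 i| <= N x.
Proof.
rewrite -sqrtr_sqr ler_sqrt; last by rewrite sumr_ge0// => j _; rewrite sqr_ge0.
by rewrite (bigD1 i)//= lerDl sumr_ge0// => j _; rewrite sqr_ge0.
Qed.

Lemma enorm_eq0 x : N x = 0 -> x = 0.
Proof.
move=> x0; apply/rowP => i; rewrite mxE; apply/normr0_eq0/eqP.
by rewrite eq_le normr_ge0 -x0 coord_le_enorm.
Qed.

Lemma enorm_gt0 x : x != 0 -> 0 < N x.
Proof.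
move=> x0; rewrite lt_neqAle enorm_ge0 andbT eq_sym.
by apply: contra x0 => /eqP/enorm_eq0->.
Qed.

Lemma cauchy_schwarz x y : \sum_(i < n) x 0 i * y 0 i <= N x * N y.
Proof.
have [->|x0] := eqVneq x 0.
  by rewrite enorm0 mul0r big1// => i _; rewrite mxE mul0r.
have [->|y0] := eqVneq y 0.
  by rewrite enorm0 mulr0 big1// => i _; rewrite mxE mulr0.
have /enorm_gt0 Nx0 := x0; have /enorm_gt0 Ny0 := y0.
(* expand the square of |y| x - |x| y *)
have : 0 <= \sum_(i < n) (N y * x 0 i - N x * y 0 i) ^+ 2.
  by rewrite sumr_ge0// => i _; rewrite sqr_ge0.
have -> : \sum_(i < n) (N y * x 0 i - N x * y 0 i) ^+ 2 =
    N y ^+ 2 * N x ^+ 2 - 2 * (N x * N y) * (\sum_(i < n) x 0 i * y 0 i) +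
    N x ^+ 2 * N y ^+ 2.
  transitivity (N y ^+ 2 * (\sum_(i < n) x 0 i ^+ 2) -
      2 * (N x * N y) * (\sum_(i < n) x 0 i * y 0 i) +
      N x ^+ 2 * (\sum_(i < n) y 0 i ^+ 2)); last by rewrite -!enorm_sqr.
  rewrite !mulr_sumr -sumrB -big_split/=.
  by apply: eq_bigr => i _; ring.
have -> : N y ^+ 2 * N x ^+ 2 - 2 * (N x * N y) * (\sum_(i < n) x 0 i * y 0 i) +
    N x ^+ 2 * N y ^+ 2 =
    2 * (N x * N y) * (N x * N y - \sum_(i < n) x 0 i * y 0 i) by ring.
by rewrite pmulr_rge0 ?subr_ge0// mulr_gt0// mulr_gt0.
Qed.

Lemma ler_enormD x y : N (x + y) <= N x + N y.
Proof.
rewrite -(@ler_pXn2r _ 2)// ?nnegrE ?addr_ge0 ?enorm_ge0//.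
have -> : N (x + y) ^+ 2 =
    N x ^+ 2 + 2 * (\sum_(i < n) x 0 i * y 0 i) + N y ^+ 2.
  rewrite !enorm_sqr mulr_sumr -!big_split/=.
  by apply: eq_bigr => i _; rewrite mxE; ring.
by have := cauchy_schwarz x y; nra.
Qed.

Lemma ler_enorm_dist x y : `|N x - N y| <= N (x - y).
Proof.
rewrite ler_norml; apply/andP; split.
  by have := ler_enormD x (y - x); rewrite addrCA subrr addr0 enormB; lra.
by have := ler_enormD (x - y) y; rewrite subrK; lra.
Qed.

Lemma enorm_delta i : N (delta_mx 0 i) = 1.
Proof.
rewrite /enorm (bigD1 i)//= mxE !eqxx expr1n big1 ?addr0 ?sqrtr1//.
by move=> j /negPf ji; rewrite mxE ji andbF expr0n.
Qed.

Lemma continuous_enorm : continuous N.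
Proof.
move=> x; apply: (@continuous_comp _ _ _
  (fun x : 'rV[R]_n => \sum_(i < n) x 0 i ^+ 2) Num.sqrt).
  apply: (@continuous_big _ _ +%R 0 xpredT); first exact: add_continuous.
  move=> i _ {}x; apply: (@continuous_comp _ _ _
    (fun x : 'rV[R]_n => x 0 i) (fun r : R => r ^+ 2)).
    exact: coord_continuous.
  exact: exprn_continuous.
exact: sqrt_continuous.
Qed.

End euclidean_norm.

(** * Affine changes of variable *)

Section product_invariance.
Local Open Scope ereal_scope.
Context {R : realType}.

(** Stated for nonnegative functions, so that Tonelli's theorem carries it to
    products without integrability assumptions. *)
Definition scales d (T : measurableType d) (m : {measure set T -> \bar R})
    (s : T -> T) (k : R) :=
  forall f : T -> \bar R, measurable_fun [set: T] f -> (forall x, 0 <= f x) ->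
    k%:E * \int[m]_x f (s x) = \int[m]_x f x.

Lemma scales_prod d1 d2 (T1 : measurableType d1) (T2 : measurableType d2)
    (m1 : {sigma_finite_measure set T1 -> \bar R})
    (m2 : {sigma_finite_measure set T2 -> \bar R}) s1 s2 (k1 k2 : R) :
  (0 <= k1)%R -> (0 <= k2)%R ->
  measurable_fun [set: T1] s1 -> measurable_fun [set: T2] s2 ->
  scales m1 s1 k1 -> scales m2 s2 k2 ->
  scales (m1 \x m2) (fun t => (s1 t.1, s2 t.2)) (k1 * k2)%R.
Proof.
move=> k10 k20 ms1 ms2 sc1 sc2 f mf f0.
have ms : measurable_fun [set: T1 * T2]
    (fun t : T1 * T2 => (s1 t.1, s2 t.2)).
  by apply/measurable_fun_pair; exact: measurableT_comp.
have mF : measurable_fun [set: T1] (fubini_F m2 f).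
  apply: measurable_fun_fubini_tonelli_F => // x; exact: f0.
have F0 x : 0 <= fubini_F m2 f x by apply: integral_ge0 => y _.
have mfs := measurableT_comp mf ms.
have mFs : measurable_fun [set: T1]
    (fubini_F m2 (f \o (fun t : T1 * T2 => (s1 t.1, s2 t.2)))).
  apply: measurable_fun_fubini_tonelli_F => // x; exact: f0.
rewrite (@fubini_tonelli1 _ _ _ _ _ m1 m2 f mf f0) -(sc1 _ mF F0) EFinM -muleA.
rewrite (@fubini_tonelli1 _ _ _ _ _ m1 m2 _ mfs)//=.
congr (_ * _); rewrite -ge0_integralZl_EFin//; last first.
  by move=> x _; apply: integral_ge0 => y _; exact: f0.
apply: eq_integral => x _; rewrite /fubini_F -(sc2 (fun y => f (s1 x, y)))//.
by apply: (measurableT_comp mf); exact: measurable_pair1.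
Qed.

(** By uniqueness of the Lebesgue measure, compared on half-open intervals with
    the rescaled image measure. *)
Lemma scales_affine (a b : R) : a != 0%R ->
  scales (@lebesgue_measure R) (fun t => a * t + b)%R `|a|%R.
Proof.
move=> a0 f mf f0.
pose phi : measurableTypeR R -> measurableTypeR R := (fun t => a * t + b)%R.
have ma : measurable_fun [set: measurableTypeR R] phi.
  by apply: measurable_funD => //; apply: measurable_funM.
have a1 : (0 <= `|a|)%R by [].
pose nu : {measure set (measurableTypeR R) -> \bar R} := mscale (NngNum a1)
  (measure_function_pushforward__canonical__measure_function_Measure (@lebesgue_measure R) ma).
have nuE A : measurable A -> lebesgue_measure A = nu A.
  move: A; apply: (@lebesgue_measure_unique R nu) => _ [[x y] /= _ <-].
  rewrite /mscale/= [pushforward _ _ _]/(lebesgue_measure (phi @^-1` `]x, y])).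
  rewrite lebesgue_measure_itv/= lte_fin.
  have [apos|aneg|/esym/eqP] := ltgtP 0%R a; last by rewrite (negbTE a0).
    have -> : phi @^-1` `]x, y] =
        `]((x - b) / a)%R, ((y - b) / a)%R]%classic.
      apply/seteqP; split => t /=; rewrite !in_itv/phi/=
        ltr_pdivrMr// ler_pdivlMr// ltrBlDr lerBrDr mulrC//.
    rewrite [X in _ * X]lebesgue_measure_itv/= lte_fin ltr_pM2r ?invr_gt0// ltrD2r.
    rewrite gtr0_norm//; case: ifPn => _; last by rewrite mule0.
    by rewrite -!EFinD -EFinM; congr EFin; field.
  have -> : phi @^-1` `]x, y] =
      `[((y - b) / a)%R, ((x - b) / a)%R[%classic.
    apply/seteqP; split => t /=; rewrite !in_itv/phi/=
      ler_ndivrMr// ltr_ndivlMr// ltrBlDr lerBrDr mulrC andbC//.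
  rewrite [X in _ * X]lebesgue_measure_itv/= lte_fin ltr_nM2r ?invr_lt0// ltrD2r.
  rewrite ltr0_norm//; case: ifPn => _; last by rewrite mule0.
  by rewrite -!EFinD -EFinM; congr EFin; field.
have -> : \int[lebesgue_measure]_x f x = \int[nu]_x f x.
  by apply: eq_measure_integral => A mA _; exact: nuE.
by rewrite ge0_integral_mscale// ge0_integral_pushforward.
Qed.

End product_invariance.

(** * Lebesgue integration on R^3 *)

Section space_integral.
Context {R : realType}.
Local Notation V := 'rV[R]_3.
Local Notation T := ((measurableTypeR R * measurableTypeR R) * measurableTypeR R)%type.

Definition vec3 (t : T) : V := \row_(i < 3) [:: t.1.1; t.1.2; t.2]`_i.

Definition area : set (measurableTypeR R * measurableTypeR R)%type -> \bar R :=
  (@lebesgue_measure R \x @lebesgue_measure R)%E.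

HB.instance Definition _ := Measure.on area.

Lemma area_sigma_finite : sigma_finite setT area.
Proof.
pose J (n : nat) : set (measurableTypeR R) := `[- n%:R, n%:R]%classic.
exists (fun n => J n `*` J n).
  apply/seteqP; split => // -[x y] _; pose n := (Num.truncn (`|x| + `|y|)).+1.
  have : `|x| + `|y| < n%:R by rewrite truncnS_gt.
  have := normr_ge0 x; have := normr_ge0 y => y0 x0 xyn.
  by exists n => //; split; rewrite /J/= in_itv/= -ler_norml; lra.
move=> n; split; first by apply: measurableX; exact: measurable_itv.
have mJ : (measurable (J n)) by exact: measurable_itv.
rewrite /area product_measure1E//= lebesgue_measure_itv/=.
by case: ifPn => _; rewrite ?mule0 ?ltry// -EFinD -EFinM ltry.
Qed.

HB.instance Definition _ :=
  Measure_isSigmaFinite.Build _ _ _ area area_sigma_finite.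

Definition volume : {measure set T -> \bar R} :=
  (area \x @lebesgue_measure R)%E.

Definition measurable3 (h : V -> R) :=
  measurable_fun [set: T] (h \o vec3).

Definition L1 (h : V -> R) := volume.-integrable [set: T] (EFin \o (h \o vec3)).

Definition integral3 (h : V -> R) : R := \int[volume]_t h (vec3 t).

Lemma vec3_surj (x : V) : exists t, vec3 t = x.
Proof.
exists (x 0 0, x 0 1, x 0 2%:R); apply/rowP => -[[|[|[|i]]] hi]//; rewrite mxE/=;
  by congr (x 0 _); apply: val_inj.
Qed.

Lemma vec3_affine (a : R) (b : V) t :
  a *: vec3 t + b =
  vec3 (a * t.1.1 + b 0 0, a * t.1.2 + b 0 1, a * t.2 + b 0 2%:R).
Proof.
apply/rowP => -[[|[|[|i]]] hi]//; rewrite !mxE/=;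
  by congr (_ + b 0 _); apply: val_inj.
Qed.

(** An open set is a countable union of boxes with rational centres. *)
Lemma open_measurable_vec3 (O : set V) : open O -> measurable (vec3 @^-1` O).
Proof.
move=> oO.
pose box (k : (rat * rat * rat) * nat) : set T :=
  (ball (ratr k.1.1.1 : R) k.2.+1%:R^-1 `*` ball (ratr k.1.1.2 : R) k.2.+1%:R^-1)
  `*` ball (ratr k.1.2 : R) k.2.+1%:R^-1.
have mbox k : measurable (box k).
  by apply: measurableX; [apply: measurableX|]; exact: measurable_ball.
pose F k : set T := if `[< box k `<=` vec3 @^-1` O >] then box k else set0.
have -> : vec3 @^-1` O = \bigcup_k F k.
  apply/seteqP; split => [t /= Ot|t [k _]]; last first.
    by rewrite /F; case: asboolP => // kO; exact: kO.
  have /nbhs_ballP[e /= e0 eO] : nbhs (vec3 t) O by exact: open_nbhs_nbhs.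
  have e20 : 0 < e / 2 by lra.
  have [m me] : exists m : nat, m.+1%:R^-1 < e / 2.
    exists (Num.truncn (e / 2)^-1); rewrite -[ltRHS]invrK ltf_pV2 ?posrE ?invr_gt0//.
    by rewrite truncnS_gt.
  have m0 : 0 < m.+1%:R^-1 :> R by rewrite invr_gt0.
  have dense (r : R) : exists p : rat, ball (ratr p : R) m.+1%:R^-1 r.
    have [|p] := @rat_in_itvoo R (r - m.+1%:R^-1) (r + m.+1%:R^-1).
      by rewrite ltrBlDr -addrA ltrDl addr_gt0.
    by rewrite in_itv/= => p01; exists p; rewrite /ball/= ltr_distl.
  have [p1 Hp1] := dense t.1.1; have [p2 Hp2] := dense t.1.2.
  have [p3 Hp3] := dense t.2.
  exists (p1, p2, p3, m) => //; rewrite /F asboolT//.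
  move=> s [[/= Hs1 Hs2] Hs3]; apply: eO; split=> [//|i j]; rewrite !mxE.
  have close p (r r' : R) : ball (ratr p : R) m.+1%:R^-1 r ->
      ball (ratr p : R) m.+1%:R^-1 r' -> ball r e r'.
    rewrite /ball/= => /lt_trans-/(_ _ me) h /lt_trans-/(_ _ me) h'; rewrite (_ : r - r' = (r - ratr p) + (ratr p - r')); last by ring.
    by rewrite (le_lt_trans (ler_normD _ _))// [`|r - _|]distrC; lra.
  case: j => -[|[|[|j]]] hj //=; [exact: (close p1)|exact: (close p2)|exact: (close p3)].
apply: countable_bigcupT_measurable => // k.
by rewrite /F; case: ifP.
Qed.

Lemma continuous_measurable3 (h : V -> R) : continuous h -> measurable3 h.
Proof.
move=> /continuousP ch; apply: (measurability _ (RGenOpens.measurableE R)).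
move=> _ [_ [a [b ->] <-]]; rewrite setTI comp_preimage.
by apply: open_measurable_vec3; apply: ch; exact: interval_open.
Qed.

End space_integral.

(** * Rules for integrals on R^3 *)

Section integral_rules.
Context {R : realType}.
Local Notation V := 'rV[R]_3.
Local Notation T := ((measurableTypeR R * measurableTypeR R) * measurableTypeR R)%type.
Local Notation I := (@integral3 R).
Implicit Types (f g h : V -> R).

Lemma L1_measurable h : L1 h -> measurable3 h.
Proof. by move=> /measurable_int/measurable_EFinP. Qed.

Lemma L1D f g : L1 f -> L1 g -> L1 (fun y => f y + g y).
Proof. by move=> /integrableD; apply. Qed.

Lemma L1B f g : L1 f -> L1 g -> L1 (fun y => f y - g y).
Proof. by move=> /integrableB; apply. Qed.

Lemma L1Z (k : R) f : L1 f -> L1 (fun y => k * f y).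
Proof. by move=> /(integrableZl _ k); apply. Qed.

Lemma L1_le f g : measurable3 f -> (forall y, `|f y| <= g y) -> L1 g -> L1 f.
Proof.
move=> mf fg; apply: le_integrable => //; first exact/measurable_EFinP.
by move=> t _; rewrite /= lee_fin (le_trans (fg _))// ler_norm.
Qed.

Lemma L1_norm f : L1 f -> L1 (fun y => `|f y|).
Proof. by move=> /integrable_abse. Qed.

Lemma integral3B f g : L1 f -> L1 g ->
  I (fun y => f y - g y) = I f - I g.
Proof. exact: RintegralB. Qed.

Lemma integral3Z (k : R) f : L1 f -> I (fun y => k * f y) = k * I f.
Proof. by move=> Lf; rewrite /integral3 RintegralZl. Qed.

Lemma integral3_sum (J : finType) (f : J -> V -> R) :
  (forall i, L1 (f i)) -> I (fun y => \sum_i f i y) = \sum_i I (f i).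
Proof.
move=> Lf; rewrite /integral3 /Rintegral.
rewrite (_ : \int[_]_x _ = \sum_i \int[volume]_t (f i (vec3 t))%:E)%E; last first.
  rewrite -integral_sum//.
  by apply: eq_integral => t _; rewrite -sumEFin.
by rewrite sum_fine// => i _; apply: integrable_fin_num => //; exact: Lf.
Qed.

Lemma integral3_ge0 f : (forall y, 0 <= f y) -> 0 <= I f.
Proof. by move=> f0; apply: Rintegral_ge0. Qed.

Lemma le_integral3 f g : L1 f -> L1 g -> (forall y, f y <= g y) -> I f <= I g.
Proof. by move=> Lf Lg fg; apply: (le_Rintegral measurableT Lf Lg) => t _; exact: fg. Qed.

Lemma le_norm_integral3 f g : measurable3 f -> (forall y, `|f y| <= g y) ->
  L1 g -> `|I f| <= I g.
Proof.
move=> mf fg Lg; have Lf := L1_le mf fg Lg.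
apply: (le_trans (le_normr_Rintegral measurableT Lf)).
exact: (le_integral3 (L1_norm Lf) Lg fg).
Qed.

Lemma eq_integral3 f g : f =1 g -> I f = I g.
Proof. by move=> /funext ->. Qed.

Lemma scales_volume (a : R) (b : V) : a != 0 ->
  scales (@volume R) (fun t => (a * t.1.1 + b 0 0, a * t.1.2 + b 0 1,
    a * t.2 + b 0 2%:R)) (`|a| ^+ 3).
Proof.
move=> a0; rewrite (_ : `|a| ^+ 3 = `|a| * `|a| * `|a|); last by ring.
have ma c : measurable_fun [set: measurableTypeR R]
    ((fun t => a * t + c) : measurableTypeR R -> measurableTypeR R).
  by apply: measurable_funD => //; apply: measurable_funM.
apply: (@scales_prod _ _ _ _ _ (@area R) (@lebesgue_measure R)
  (fun t => (a * t.1 + b 0 0, a * t.2 + b 0 1)) (fun t => a * t + b 0 2%:R)).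
- exact: mulr_ge0.
- exact: normr_ge0.
- apply/measurable_fun_pair.
    exact: (measurableT_comp (ma (b 0 0)) measurable_fst).
  exact: (measurableT_comp (ma (b 0 1)) measurable_snd).
- exact: (ma (b 0 2%:R)).
- apply: (@scales_prod _ _ _ _ _ (@lebesgue_measure R) (@lebesgue_measure R)
    (fun t => a * t + b 0 0) (fun t => a * t + b 0 1)) => //.
  + exact: (@scales_affine R a (b 0 0)).
  + exact: (@scales_affine R a (b 0 1)).
- exact: (@scales_affine R a (b 0 2%:R)).
Qed.

Lemma measurable3_affine (a : R) (b : V) h :
  measurable3 h -> measurable3 (fun y => h (a *: y + b)).
Proof.
move=> mh; rewrite /measurable3 (_ : _ \o _ = (h \o vec3) \o
  (fun t : T => (a * t.1.1 + b 0 0, a * t.1.2 + b 0 1, a * t.2 + b 0 2%:R))).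
  apply: measurableT_comp => //.
  have ma c : measurable_fun [set: measurableTypeR R]
      ((fun t => a * t + c) : measurableTypeR R -> measurableTypeR R).
    by apply: measurable_funD => //; apply: measurable_funM.
  apply/measurable_fun_pair; [apply/measurable_fun_pair|].
  - apply: (measurableT_comp (ma (b 0 0))).
    exact: (measurableT_comp measurable_fst measurable_fst).
  - apply: (measurableT_comp (ma (b 0 1))).
    exact: (measurableT_comp measurable_snd measurable_fst).
  - exact: (measurableT_comp (ma (b 0 2%:R)) measurable_snd).
by apply/funext => t /=; rewrite vec3_affine.
Qed.

Lemma ge0_integral_affine (a : R) (b : V) h : a != 0 -> measurable3 h ->
  (forall y, 0 <= h y) ->
  ((`|a| ^+ 3)%:E * \int[@volume R]_t (h (a *: vec3 t + b))%:E =
   \int[@volume R]_t (h (vec3 t))%:E)%E.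
Proof.
move=> a0 mh h0; rewrite -[RHS](scales_volume b a0); last 2 first.
- exact: ((measurable_EFinP _ _).2 mh).
- by move=> t; rewrite lee_fin.
by congr (_ * _)%E; apply: eq_integral => t _; rewrite vec3_affine.
Qed.

Lemma L1_affine (a : R) (b : V) h : a != 0 -> L1 h ->
  L1 (fun y => h (a *: y + b)).
Proof.
move=> a0 Lh; have mh := L1_measurable Lh; apply/integrableP; split.
  by apply/measurable_EFinP; exact: (measurable3_affine a b mh).
have /integrableP[_] := Lh.
have := @ge0_integral_affine a b (fun y => `|h y|) a0.
move=> /(_ (measurableT_comp (@normr_measurable R setT) mh)).
rewrite /comp => <-//; move: (\int[_]_t _)%E => [r _||//].
  by rewrite ltry.
by rewrite gt0_muley// lte_fin exprn_gt0// normr_gt0.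
Qed.

(** Reduced to nonnegative functions by splitting off the negative part. *)
Lemma integral3_affine (a : R) (b : V) h : a != 0 -> L1 h ->
  `|a| ^+ 3 * I (fun y => h (a *: y + b)) = I h.
Proof.
move=> a0 Lh; have mh := L1_measurable Lh.
pose hp y := Num.max (h y) 0; pose hn y := Num.max (- h y) 0.
have Lp : L1 hp.
  apply: (L1_le _ _ (L1_norm Lh)); first exact: measurable_funrpos.
  by move=> y; rewrite /hp ger0_norm ?le_max ?lexx ?orbT// ge_max ler_norm normr_ge0.
have Ln : L1 hn.
  apply: (L1_le _ _ (L1_norm Lh)); first exact: measurable_funrneg.
  by move=> y; rewrite /hn ger0_norm ?le_max ?lexx ?orbT// ge_max -normrN ler_norm normr_ge0.
have E y : h y = hp y - hn y.
  by rewrite /hp /hn; have [h0|h0] := lerP (h y) 0; have [h1|h1] := lerP (- h y) 0; lra.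
rewrite (eq_integral3 E) (eq_integral3 (fun y => E (a *: y + b))).
rewrite !integral3B//; [|exact: (L1_affine b a0 Lp)|exact: (L1_affine b a0 Ln)].
have pos f : (forall y, 0 <= f y) -> L1 f ->
    `|a| ^+ 3 * I (fun y => f (a *: y + b)) = I f.
  move=> f0 Lf; rewrite /integral3 /Rintegral.
  rewrite -(ge0_integral_affine b a0 (L1_measurable Lf) f0) fineM//.
  by apply: integrable_fin_num => //; exact: (L1_affine b a0 Lf).
by rewrite mulrBr !pos// => y; rewrite le_max lexx orbT.
Qed.

Lemma L1_shift a h : L1 h -> L1 (fun y => h (y + a)).
Proof.
move=> /(@L1_affine 1 a h (oner_neq0 _)).
by rewrite (_ : (fun _ => _) = (fun y => h (y + a)))//; apply/funext => y;
  rewrite scale1r.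
Qed.

Lemma integral3_shift a h : L1 h -> I (fun y => h (y + a)) = I h.
Proof.
move=> /(integral3_affine a (oner_neq0 _)) <-.
rewrite normr1 expr1n mul1r; apply: eq_integral3 => y.
by rewrite scale1r.
Qed.

Lemma L1_reflect x h : L1 h -> L1 (fun y => h (x - y)).
Proof.
have n1 : -1 != 0 :> R by rewrite oppr_eq0 oner_neq0.
move=> /(@L1_affine (-1) x h n1).
by rewrite (_ : (fun _ => _) = (fun y => h (x - y)))//; apply/funext => y;
  rewrite scaleN1r addrC.
Qed.

Lemma integral3_reflect x h : L1 h -> I (fun y => h (x - y)) = I h.
Proof.
have n1 : -1 != 0 :> R by rewrite oppr_eq0 oner_neq0.
move=> /(integral3_affine x n1) <-.
rewrite normrN normr1 expr1n mul1r; apply: eq_integral3 => y.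
by rewrite scaleN1r addrC.
Qed.

Lemma integral3_dilate (a : R) h : 0 < a -> L1 h ->
  a ^+ 3 * I (fun y => h (a *: y)) = I h.
Proof.
move=> a0 /(integral3_affine 0 (lt0r_neq0 a0)) <-.
by rewrite gtr0_norm//; congr (_ * _); apply: eq_integral3 => y; rewrite addr0.
Qed.

Lemma set1X1 (A B : Type) (a : A) (b : B) :
  [set a] `*` [set b] = [set (a, b)].
Proof. by apply/seteqP; split=> [[? ?] [/= -> ->]|? ->]. Qed.

Lemma volume_set1 (t : T) : @volume R [set t] = 0%E.
Proof.
case: t => -[t1 t2] t3.
have m1 (r : R) : measurable ([set r] : set (measurableTypeR R)).
  exact: measurable_set1.
have m2 : measurable ([set (t1, t2)] : set (measurableTypeR R * measurableTypeR R)).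
  by rewrite -set1X1; exact: measurableX.
rewrite -set1X1; apply: (eq_trans (product_measure1E _ _ m2 (m1 t3))).
by rewrite [X in (_ * X)%E](lebesgue_measure_set1 t3) mule0.
Qed.

(** Pointwise convergence may fail at one point: the norm is not differentiable,
    and its gradient not continuous, at the origin. *)
Lemma dominated_integral3 (f_ : nat -> V -> R) f g (p : V) :
  (forall n, measurable3 (f_ n)) -> measurable3 f ->
  (forall y, y != p -> f_ n y @[n --> \oo] --> f y) ->
  (forall n y, `|f_ n y| <= g y) -> L1 g ->
  I (f_ n) @[n --> \oo] --> I f.
Proof.
move=> mf_ mf f_f f_g Lg; have [t0 t0p] := vec3_surj p.
have ae : {ae @volume R, forall t, [set: T] t ->
    (f_ n (vec3 t))%:E @[n --> \oo] --> (f (vec3 t))%:E}.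
  exists [set t0]; split; [|exact: volume_set1|].
    case: (t0) => -[t1 t2] t3; rewrite -!set1X1.
    by apply: measurableX; [apply: measurableX|]; exact: measurable_set1.
  move=> t /= /not_implyP[_]; apply: contra_notP => /= tt0.
  apply: cvg_EFin; first exact: nearW.
  apply: f_f; apply/eqP => tp; apply: tt0.
  move: tp; rewrite -t0p => /rowP tp.
  move: (tp 0) (tp 1) (tp 2%:R); rewrite !mxE/=.
  by case: (t) => -[? ?] ?; case: (t0) => -[? ?] ?/= -> -> ->.
have [If _ cvgI] := @dominated_convergence _ _ _ (@volume R) [set: T] measurableT
  (fun n t => (f_ n (vec3 t))%:E) (fun t => (f (vec3 t))%:E)
  (fun t => (g (vec3 t))%:E)
  (fun n => (measurable_EFinP _ _).2 (mf_ n)) ((measurable_EFinP _ _).2 mf) ae Lg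
  (aeW _ (fun t n _ => f_g n (vec3 t))).
by apply: fine_cvg; rewrite fineK//; exact: (integrable_fin_num measurableT If).
Qed.

End integral_rules.

(** * Powers of the weight 1 + |x| *)

Section weight.
Context {R : realType}.
Local Notation V := 'rV[R]_3.
Local Notation T := ((measurableTypeR R * measurableTypeR R) * measurableTypeR R)%type.
Local Notation N := (@enorm R 3).

Lemma cvg_powR (S : Type) (F : set_system S) (FF : Filter F) (f : S -> R) (p l : R) :
  0 < l -> f @ F --> l -> f x `^ p @[x --> F] --> l `^ p.
Proof.
move=> l0 fl; apply: (@cvg_comp _ _ _ f (fun r => r `^ p) _ (nbhs l)) => //.
suff /differentiable_continuous : differentiable (fun r : R => r `^ p) l by [].
by apply/derivable1_diffP; apply: ex_derive; exact: is_derive1_powR.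
Qed.

Lemma cvg_powR_infty (p : R) : 0 < p -> (1 + t) `^ (- p) @[t --> +oo] --> (0 : R).
Proof.
move=> p0; apply/cvgrPdist_lt => e e0; near=> t.
pose A := e^-1 `^ p^-1.
have At : A < t by near: t; apply: nbhs_pinfty_gt; exact: num_real.
have A0 : 0 <= A by exact: powR_ge0.
rewrite sub0r normrN ger0_norm ?powR_ge0// powRN.
rewrite -[ltRHS]invrK ltf_pV2 ?posrE ?invr_gt0// ?powR_gt0//; last by lra.
rewrite [X in X < _](_ : _ = A `^ p); last first.
  by rewrite /A -powRrM mulVf ?gt_eqF// powRr1// invr_ge0 ltW.
by apply: gt0_ltr_powR => //; rewrite ?nnegrE; lra.
Unshelve. all: by end_near. Qed.

Lemma integrable_weight1 (s : R) : 1 < s ->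
  (@lebesgue_measure R).-integrable [set: R] (fun t => ((1 + `|t|) `^ (- s))%:E).
Proof.
move=> s1; have c : continuous (fun t : R => (1 + `|t|) `^ (- s)).
  move=> t; apply: cvg_powR; first by have := normr_ge0 t; lra.
  by apply: cvgD; [exact: cvg_cst|exact: norm_continuous].
apply/integrableP; split.
  by apply/measurable_EFinP; exact: continuous_measurable_fun.
under eq_integral do rewrite gee0_abs ?lee_fin ?powR_ge0//.
rewrite ge0_symfun_integralT//; last by move=> t /=; rewrite normrN.
have -> : [set x : R | 0 <= x] = `[0, +oo[%classic :> set R.
  by apply/seteqP; split=> x /=; rewrite in_itv/= andbT.
rewrite (_ : \int[_]_(x in _) _ =
    \int[lebesgue_measure]_(x in `[0%R, +oo[) ((1 + x) `^ (- s))%:E)%E; last first.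
  by apply: eq_integral => x; rewrite inE/= in_itv/= andbT => x0;
    rewrite ger0_norm.
have d (x : R) : 0 <= x -> is_derive x 1 (fun x : R => - (s - 1)^-1 * (1 + x) `^ (- (s - 1)))
    ((1 + x) `^ (- s)).
  move=> x0; have x10 : 0 < 1 + x by lra.
  have := is_derive1_powR (- (s - 1)) x10 => dp.
  have : is_derive x 1 (fun x : R => 1 + x) 1.
    have := is_deriveD (is_derive_cst (1 : R) x (1 : R)) (is_derive_id x (1 : R)).
    by rewrite add0r.
  move=> /(@is_derive1_comp _ _ _ _ _ _ dp) h.
  have := @is_deriveZ _ _ _ _ (- (s - 1)^-1) _ _ _ h.
  rewrite (_ : _ *: _ = (1 + x) `^ (- s))//.
  rewrite /GRing.scale/= mulr1 mulrA mulNr mulrN opprK mulVf ?mul1r; last by lra.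
  by congr (_ `^ _); ring.
rewrite (@ge0_continuous_FTC2y R _
  (fun x => - (s - 1)^-1 * (1 + x) `^ (- (s - 1))) 0 (- (s - 1)^-1 * 0)).
- by rewrite -EFinB -EFinM ltry.
- by move=> x _; exact: powR_ge0.
- apply: continuous_in_subspaceT => x; rewrite inE/= in_itv/= andbT => x0.
  by apply: cvg_powR; [lra|apply: cvgD; [exact: cvg_cst|exact: cvg_id]].
- by apply: cvgM; [exact: cvg_cst|apply: cvg_powR_infty; lra].
- by move=> x /ltW /d [].
- have [/derivable1_diffP/differentiable_continuous + _] := d 0 (lexx _).
  by move=> /cvg_at_right_filter.
- move=> x; rewrite in_itv/= andbT => /ltW/d dx.
  by rewrite derive1E; apply: derive_val.
Qed.

Lemma integrable_prod d1 d2 (T1 : measurableType d1) (T2 : measurableType d2)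
    (m1 : {sigma_finite_measure set T1 -> \bar R})
    (m2 : {sigma_finite_measure set T2 -> \bar R}) (f : T1 -> R) (g : T2 -> R) :
  m1.-integrable setT (EFin \o f) -> m2.-integrable setT (EFin \o g) ->
  (m1 \x m2)%E.-integrable setT (fun t => (f t.1 * g t.2)%:E).
Proof.
move=> If Ig.
have mf : measurable_fun [set: T1] f by apply/measurable_EFinP; exact: (measurable_int m1).
have mg : measurable_fun [set: T2] g by apply/measurable_EFinP; exact: (measurable_int m2).
apply/integrable12ltyP.
  apply/measurable_EFinP; apply: measurable_funM; exact: measurableT_comp.
rewrite (_ : (\int[_]_x _)%E =
   (\int[m1]_x (`|(f x)%:E| * \int[m2]_y `|(g y)%:E|))%E).
  rewrite ge0_integralZr//.
  - apply: lte_mul_pinfty.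
    + exact: integral_ge0.
    + by have := integrable_fin_num measurableT (integrable_abse If).
    + by have /integrableP[] := Ig.
  - by apply: measurableT_comp => //; exact/measurable_EFinP.
  - exact: integral_ge0.
apply: eq_integral => x _; rewrite -ge0_integralZl//.
- by apply: eq_integral => y _; rewrite EFinM abseM.
- by apply: measurableT_comp => //; exact/measurable_EFinP.
Qed.

Definition weight (y : V) : R := 1 + N y.
Local Notation w := weight.

Lemma weight_ge1 y : 1 <= w y.
Proof. by rewrite /weight lerDl enorm_ge0. Qed.

Lemma weight_gt0 y : 0 < w y.
Proof. exact: lt_le_trans (weight_ge1 y). Qed.

Lemma weight_ge0 y : 0 <= w y. Proof. exact/ltW/weight_gt0. Qed.

#[local] Hint Resolve weight_ge0 weight_gt0 : core.

Lemma weightN y : w (- y) = w y. Proof. by rewrite /weight enormN. Qed.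

Lemma weightM x y : w (x + y) <= w x * w y.
Proof.
have := ler_enormD x y; have := enorm_ge0 x; have := enorm_ge0 y.
rewrite /weight; nra.
Qed.

Lemma weight_powR_gt0 y a : 0 < w y `^ a.
Proof. exact: powR_gt0. Qed.

Lemma weight_powRD y a b : w y `^ (a + b) = w y `^ a * w y `^ b.
Proof. by rewrite powRD//; apply/implyP => _; rewrite gt_eqF. Qed.

Lemma weight_powR_le y a b : a <= b -> w y `^ a <= w y `^ b.
Proof. by move=> ab; apply: ler_powR => //; exact: weight_ge1. Qed.

Lemma ge0_weight_powR_reflect x z b : 0 <= b ->
  w (x - z) `^ b <= w x `^ b * w z `^ b.
Proof.
move=> b0; rewrite -powRM//.
apply: ge0_ler_powR; rewrite ?nnegrE ?mulr_ge0//.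
by rewrite -[w z]weightN; exact: weightM.
Qed.

(** For a negative exponent, apply submultiplicativity to [z = x - (x - z)]. *)
Lemma weight_powR_reflect x z b :
  w (x - z) `^ b <= w x `^ `|b| * w z `^ b.
Proof.
have [b0|b0] := leP 0 b; first by rewrite ger0_norm// ge0_weight_powR_reflect.
have inv y : w y `^ b = (w y `^ (- b))^-1 by rewrite -powRN opprK.
rewrite !inv ltr0_norm//; have A0 := weight_powR_gt0 (x - z) (- b).
have B0 := weight_powR_gt0 z (- b).
rewrite -(ler_pM2l A0) mulfV ?gt_eqF// mulrA ler_pdivlMr// mul1r mulrC.
have -> : w z = w (x - (x - z)) by rewrite opprB addrCA subrr addr0.
by apply: ge0_weight_powR_reflect; lra.
Qed.

Lemma continuous_weight : continuous w.
Proof.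
move=> y.
have c1 : {for y, continuous (fun _ : V => 1 : R)} by exact: cst_continuous.
have cN : {for y, continuous N} by exact: continuous_enorm.
exact: (continuousD c1 cN).
Qed.

Lemma continuous_weight_powR a : continuous (fun y => w y `^ a).
Proof. by move=> y; exact: cvg_powR (weight_gt0 y) (@continuous_weight y). Qed.

(** Each coordinate is dominated by the norm, so a third of the exponent can be
    spent on each of them; the integral then factors. *)
Lemma L1_weight (s : R) : 3 < s -> L1 (fun y => w y `^ (- s)).
Proof.
move=> s3; pose g (t : R) := (1 + `|t|) `^ (- (s / 3)).
have Ig : (@lebesgue_measure R).-integrable [set: R] (EFin \o g).
  by apply: integrable_weight1; lra.
have Igg : (@area R).-integrable setT (EFin \o (fun t => g t.1 * g t.2)).
  exact: (integrable_prod Ig Ig).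
have Iggg := integrable_prod Igg Ig.
apply: (@le_integrable _ _ _ _ _ measurableT _
    (fun t : T => (g t.1.1 * g t.1.2 * g t.2)%:E)) => //.
  apply/measurable_EFinP; apply: continuous_measurable3.
  exact: continuous_weight_powR.
move=> t _; rewrite /= lee_fin ger0_norm ?powR_ge0//.
apply: le_trans (ler_norm _).
have -> : w (vec3 t) `^ (- s) = w (vec3 t) `^ (- (s / 3)) *
    w (vec3 t) `^ (- (s / 3)) * w (vec3 t) `^ (- (s / 3)).
  by rewrite -!weight_powRD; congr (_ `^ _); field.
have le i : w (vec3 t) `^ (- (s / 3)) <= g (vec3 t 0 i).
  have u0 : 0 < 1 + `|vec3 t 0 i| by have := normr_ge0 (vec3 t 0 i); lra.
  rewrite /g !powRN lef_pV2 ?posrE ?powR_gt0//.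
  apply: ge0_ler_powR; rewrite ?nnegrE ?(ltW u0)//; first by lra.
  by rewrite /weight lerD2l coord_le_enorm.
have := le 0; have := le 1; have := le 2%:R; rewrite !mxE/= => h2 h1 h0.
by rewrite !ler_pM ?mulr_ge0 ?powR_ge0.
Qed.

End weight.
#[global] Hint Extern 0 (is_true (0 <= weight _)) => exact: weight_ge0 : core.
#[global] Hint Extern 0 (is_true (0 < weight _)) => exact: weight_gt0 : core.

(** * Limits and derivatives of parametric integrals *)

Section limits.
Context {R : realType}.
Local Notation V := 'rV[R]_3.
Local Notation I := (@integral3 R).

(** For such a filter limits can be tested along sequences, which is what the
    dominated convergence theorem requires. *)
Definition countably_based (S : Type) (F : set_system S) :=
  exists b : nat -> set S, (forall n, F (b n)) /\
    forall A, F A -> exists n, forall m, (n <= m)%N -> b m `<=` A.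

Lemma cvg_countably_based (S : Type) (F : set_system S) (FF : Filter F)
    (G : S -> R) (l : R) : countably_based F ->
  (forall u : nat -> S, u n @[n --> \oo] --> F -> G (u n) @[n --> \oo] --> l) ->
  G x @[x --> F] --> l.
Proof.
move=> [b [Fb bF]] Gu; apply: contrapT => /cvgrPdist_lt/existsNP[e].
move=> /not_implyP[e0 nF].
have ex n : exists x, b n x /\ e <= `|l - G x|.
  apply: contrapT => nex; apply: nF; apply: filterS (Fb n) => x bx.
  by rewrite ltNge; apply/negP => ex; apply: nex; exists x.
have [u Hu] := choice ex.
have uF : u n @[n --> \oo] --> F.
  move=> A /bF[n nA]; exists n => // m /= nm; apply: (nA m nm).
  exact: (Hu m).1.
have /cvgrPdist_lt/(_ e e0)[n _ /(_ n (leqnn n))] := Gu u uF.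
by rewrite /= ltNge (Hu n).2.
Qed.

Lemma inv_lt_near (e : R) : 0 < e ->
  exists n, forall m, (n <= m)%N -> m.+1%:R^-1 < e.
Proof.
move=> e0; exists (Num.truncn e^-1) => m nm.
rewrite -[ltRHS]invrK ltf_pV2 ?posrE ?invr_gt0//.
by rewrite (lt_le_trans (truncnS_gt _))// ler_nat ltnS.
Qed.

Lemma countably_based_nbhs (x : V) : countably_based (nbhs x).
Proof.
exists (fun n => ball x n.+1%:R^-1); split=> [n|A].
  by apply: nbhsx_ballx; rewrite invr_gt0.
move=> /nbhs_ballP[e /= e0 eA]; have [n nP] := inv_lt_near e0.
by exists n => m /nP/ltW me; apply: subset_trans eA; exact: le_ball.
Qed.

Lemma countably_based_dnbhs0 : countably_based (0 : R)^'.
Proof.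
exists (fun n => [set t | `|t| < n.+1%:R^-1 /\ t != 0]); split=> [n|A].
  have n0 : 0 < n.+1%:R^-1 :> R by rewrite invr_gt0.
  by near=> t; split; near: t; [exact: (dnbhs0_lt n0)|exact: nbhs_dnbhs_neq].
move=> /nbhs_ballP[e /= e0 eA]; have [n nP] := inv_lt_near e0.
exists n => m /nP me t /= [tm t0]; apply: eA => //.
by rewrite /ball/= sub0r normrN (lt_trans tm).
Unshelve. all: by end_near. Qed.

Lemma countably_based_infty : countably_based (@enorm_infty R 3).
Proof.
exists (fun n => [set x | n%:R < enorm x]); split=> [n|A [M _ MA]].
  by exists n%:R.
exists (Num.truncn M).+1 => m nm x /= mx; apply: MA => /=.
apply: lt_trans mx; apply: (lt_le_trans (truncnS_gt M)).
by rewrite ler_nat.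
Qed.

Lemma cvg_integral3 (S : Type) (F : set_system S) (FF : Filter F)
    (A : S -> V -> R) (f g : V -> R) (p : V) : countably_based F ->
  (forall s, measurable3 (A s)) -> measurable3 f -> L1 g ->
  (\forall s \near F, forall y, `|A s y| <= g y) ->
  (forall y, y != p -> A s y @[s --> F] --> f y) ->
  I (A s) @[s --> F] --> I f.
Proof.
move=> cF mA mf Lg Ag Af; apply: cvg_countably_based => // u uF.
have [n _ nP] := uF _ Ag.
rewrite -(cvg_shiftn n).
apply: (@dominated_integral3 _ (fun k => A (u (k + n)%N)) f g p) => //.
- move=> y yp; rewrite (cvg_shiftn n (fun k => A (u k) y)).
  exact: (cvg_comp _ _ uF (Af y yp)).
- by move=> k y; apply: (nP (k + n)%N); rewrite /= leq_addl.
Qed.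

Lemma continuous_integral3 (A : V -> V -> R) (g : V -> R) (x p : V) :
  (forall x, measurable3 (A x)) -> L1 g ->
  (\forall x' \near x, forall y, `|A x' y| <= g y) ->
  (forall y, y != p -> {for x, continuous (A ^~ y)}) ->
  {for x, continuous (fun x => I (A x))}.
Proof.
move=> mA Lg Ag Ac; apply: (@cvg_integral3 _ (nbhs x) _ A (A x) g p) => //.
exact: countably_based_nbhs.
Qed.

(** The increments are controlled only on the line through [x], and the kernel may
    fail to be differentiable at one point [p]: the Lipschitz bound [B] makes up
    for both. *)
Lemma is_derive_integral3 (A : V -> V -> R) (A' B : V -> R) (x v p : V) :
  (forall t, L1 (A (t *: v + x))) -> L1 B -> measurable3 A' ->
  (forall t y, `|t| <= 1 -> `|A (t *: v + x) y - A x y| <= `|t| * B y) ->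
  (forall y, y != p -> is_derive x v (A ^~ y) (A' y)) ->
  is_derive x v (fun x => I (A x)) (I A').
Proof.
move=> LAt LB mA' AB dA.
have LA : L1 (A x) by have := LAt 0; rewrite scale0r add0r.
suff h : t^-1 *: (I (A (t *: v + x)) - I (A x)) @[t --> (0 : R)^'] --> I A'.
  by split; [exact: cvgP h|exact: cvg_lim h].
have -> : (fun t => t^-1 *: (I (A (t *: v + x)) - I (A x))) =
    (fun t => I (fun y => t^-1 * (A (t *: v + x) y - A x y))).
  by apply/funext => t; rewrite integral3Z ?integral3B//; exact: L1B.
apply: (@cvg_integral3 _ _ _ _ A' B p) => //.
- exact: countably_based_dnbhs0.
- by move=> t; apply: L1_measurable; apply/L1Z/L1B.
- near=> t => y.
  have t0 : t != 0 by near: t; exact: nbhs_dnbhs_neq.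
  have t1 : `|t| <= 1 by near: t; exact: dnbhs0_le.
  by rewrite normrM normfV ler_pdivrMl ?normr_gt0// AB.
- move=> y yp; have [dAy <-] := dA y yp.
  exact: dAy.
Unshelve. all: by end_near. Qed.

End limits.

(** * Directional derivatives and a class of functions of polynomial growth *)

Section directional_calculus.
Context {R : realType}.
Local Notation V := 'rV[R]_3.
Implicit Types (f g : V -> R) (x v : V).

(** A directional derivative is the derivative of a function of one variable; this
    gives access to the chain rule and to the mean value theorem. *)
Lemma is_derive_lineP f x v (s df : R) :
  is_derive (s *: v + x) v f df <->
  is_derive s 1 (fun t : R => f (t *: v + x)) df.
Proof.
have E : (fun h : R => h^-1 *: ((f \o shift (s *: v + x)) (h *: v) - f (s *: v + x))) =
  (fun h : R => h^-1 *: (((fun t : R => f (t *: v + x)) \o shift s) (h *: (1 : R)) -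
     f (s *: v + x))).
  by apply/funext => h /=; rewrite [h *: 1]mulr1 scalerDl addrA.
split=> -[dfx dfE]; split.
- by move: dfx; rewrite /derivable E.
- by move: dfE; rewrite /derive E.
- by rewrite /derivable E.
- by rewrite /derive E.
Qed.

Lemma mean_value_le f x v (t M : R) :
  (forall y, derivable f y v) ->
  (forall s, `|s| <= `|t| -> `|'D_v f (s *: v + x)| <= M) ->
  `|f (t *: v + x) - f x| <= `|t| * M.
Proof.
move=> df dM; pose F (s : R) := f (s *: v + x).
have dF (s : R) : is_derive s 1 F ('D_v f (s *: v + x)).
  by apply/is_derive_lineP; apply: DeriveDef.
have cF : continuous F.
  move=> s; have [/derivable1_diffP/differentiable_continuous + _] := dF s.
  exact.
have F0 : f x = F 0 by rewrite /F scale0r add0r.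
rewrite F0 -[f (t *: v + x)]/(F t).
have [t0|t0] := leP 0 t.
  have [c] := @MVT_segment R F (fun s => 'D_v f (s *: v + x)) 0 t t0
    (fun s _ => dF s) (continuous_subspaceT cF).
  rewrite in_itv/= => /andP[c0 ct] ->; rewrite subr0 normrM mulrC.
  by apply: ler_wpM2l => //; apply: dM; rewrite !ger0_norm// (le_trans c0).
have [c] := @MVT_segment R F (fun s => 'D_v f (s *: v + x)) t 0 (ltW t0)
  (fun s _ => dF s) (continuous_subspaceT cF).
rewrite in_itv/= => /andP[ct c0]; rewrite distrC => ->; rewrite sub0r normrM normrN mulrC.
apply: ler_wpM2l => //; apply: dM; rewrite (ltr0_norm t0) ler0_norm ?lerN2//.
Qed.

Lemma is_derive_powR f x v (p df : R) : 0 < f x -> is_derive x v f df ->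
  is_derive x v (fun y => f y `^ p) (p * f x `^ (p - 1) * df).
Proof.
move=> f0; rewrite -[in is_derive x v f df](add0r x) -(scale0r v) => /is_derive_lineP d1.
have f0' : 0 < f (0 *: v + x) by rewrite scale0r add0r.
have := is_derive1_comp (is_derive1_powR p f0') d1.
rewrite -[in X in _ -> X](add0r x) -(scale0r v) => d2; exact/is_derive_lineP.

Qed.

Lemma is_derive_coord (i : 'I_3) x v : is_derive x v (fun y : V => y 0 i) (v 0 i).
Proof.
suff h : t^-1 *: ((t *: v + x) 0 i - x 0 i) @[t --> (0 : R)^'] --> v 0 i.
  by split; [exact: cvgP h|exact: cvg_lim h].
apply: cvg_near_cst; near=> t.
have t0 : t != 0 by near: t; exact: nbhs_dnbhs_neq.
by rewrite !mxE addrK /GRing.scale/= mulrA mulVf// mul1r.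
Unshelve. all: by end_near. Qed.

Lemma is_derive_sumr (F : 'I_3 -> V -> R) (dF : 'I_3 -> R) x v :
  (forall i, is_derive x v (F i) (dF i)) ->
  is_derive x v (fun y => \sum_i F i y) (\sum_i dF i).
Proof.
move=> d; rewrite (_ : (fun y => _) = \sum_i F i); first exact: is_derive_sum.
by apply/funext => y; rewrite fct_sumE.
Qed.

Lemma sum_delta (a : 'I_3 -> R) (i : 'I_3) :
  \sum_j a j * (delta_mx 0 i : V) 0 j = a i.
Proof.
rewrite (bigD1 i)//= big1 => [|j /negPf ji]; last by rewrite mxE eqxx/= ji mulr0.
by rewrite mxE !eqxx mulr1 addr0.
Qed.

Lemma is_derive_diagonal_form (a : 'I_3 -> R) (i : 'I_3) x :
  is_derive x (delta_mx 0 i : V) (fun y : V => \sum_j a j * y 0 j ^+ 2)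
    (2 * a i * x 0 i).
Proof.
rewrite -(sum_delta (fun j => 2 * a j * x 0 j) i); apply: is_derive_sumr => j.
have dj := is_derive_coord j x (delta_mx 0 i : V).
have d := is_deriveZ (a j) (is_deriveM dj dj); apply: (is_derive_eq d).
by rewrite /GRing.scale/=; ring.
Qed.

Lemma is_derive_reflect f x y v (df : R) : is_derive (x - y) v f df ->
  is_derive x v (fun x => f (x - y)) df.
Proof.
have E : (fun h : R => h^-1 *: (((fun x => f (x - y)) \o shift x) (h *: v) - f (x - y))) =
    (fun h : R => h^-1 *: ((f \o shift (x - y)) (h *: v) - f (x - y))).
  by apply/funext => h /=; rewrite addrA.
by case=> dfx dfE; split; [rewrite /derivable E|rewrite /derive E].
Qed.

End directional_calculus.

Section growth.
Context {R : realType}.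
Local Notation V := 'rV[R]_3.
Local Notation e i := (delta_mx 0 i : V).
Implicit Types (f g : V -> R).

(** Differentiation does not lower the exponent [s]. A common bound for all
    derivatives is enough for convolutions to converge, and it makes the class
    stable under products without bookkeeping. *)
Fixpoint growth (k : nat) (s : R) (f : V -> R) : Prop :=
  [/\ continuous f, exists C, forall x, `|f x| <= C * weight x `^ s &
    if k is k'.+1 then forall i,
      (forall x, derivable f x (e i)) /\ growth k' s (partial i f)
    else True].

Lemma growth_continuous k s f : growth k s f -> continuous f.
Proof. by case: k => [|k] []. Qed.

Lemma growth_bound k s f : growth k s f ->
  exists2 C, 0 <= C & forall x, `|f x| <= C * weight x `^ s.
Proof.
have pos C : (forall x, `|f x| <= C * weight x `^ s) -> 0 <= C.
  by move=> /(_ 0)/(le_trans (normr_ge0 _)); rewrite pmulr_lge0 ?powR_gt0.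
by case: k => [|k] [_ [C fC] _]; exists C => //; exact: pos.
Qed.

Lemma growth_derivable k s f i x : growth k.+1 s f -> derivable f x (e i).
Proof. by case=> _ _ /(_ i)[]. Qed.

Lemma growth_is_derive k s f i x : growth k.+1 s f ->
  is_derive x (e i) f (partial i f x).
Proof. by move=> /growth_derivable d; exact: DeriveDef. Qed.

Lemma growth_partial k s f i : growth k.+1 s f -> growth k s (partial i f).
Proof. by case=> _ _ /(_ i)[]. Qed.

Lemma growth_C_k k s f : growth k s f -> C_k k f.
Proof.
elim: k f => [|k IH] f; first by case.
by move=> [cf _ df]; split=> // i; have [? /IH] := df i.
Qed.

Lemma growthW k s f : growth k.+1 s f -> growth k s f.
Proof.
elim: k f => [|k IH] f; first by case.
by move=> [cf bf df]; split=> // i; have [? /IH] := df i.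
Qed.

Lemma growth_le k s s' f : s <= s' -> growth k s f -> growth k s' f.
Proof.
move=> ss'; have bnd g C : 0 <= C -> (forall x, `|g x| <= C * weight x `^ s) ->
    exists C, forall x, `|g x| <= C * weight x `^ s'.
  move=> C0 gC; exists C => x; apply: (le_trans (gC x)).
  by apply: ler_wpM2l => //; exact: weight_powR_le.
elim: k f => [|k IH] f gf; have [C C0 fC] := growth_bound gf.
  by split; [exact: growth_continuous gf|exact: bnd C0 fC|].
split; [exact: growth_continuous gf|exact: bnd C0 fC|].
move=> i; split; last exact/IH/growth_partial.
by move=> x; exact: growth_derivable gf.
Qed.

Lemma growthS k s f (df : 'I_3 -> V -> R) : growth 0 s f ->
  (forall i x, is_derive x (e i) f (df i x)) ->
  (forall i, growth k s (df i)) -> growth k.+1 s f.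
Proof.
move=> [cf bf _] dfE gdf; split=> // i; split; first by move=> x; have [] := dfE i x.
rewrite (_ : partial i f = df i)//; apply/funext => x.
by have [_ ] := dfE i x.
Qed.

Lemma growth_cst k (c : R) : growth k 0 (cst c).
Proof.
have g0 c' : growth 0 0 (cst c').
  split=> //; first exact: cst_continuous.
  by exists `|c'| => x; rewrite powRr0 mulr1.
elim: k c => [//|k IH] c; apply: (@growthS _ _ _ (fun _ => cst 0)) => //.
Qed.

Lemma growth0 k s f : growth k s f -> growth 0 s f.
Proof. by elim: k => // k IH /growthW. Qed.

Lemma growthD k s f g : growth k s f -> growth k s g ->
  growth k s (fun x => f x + g x).
Proof.
have g0 f' g' : growth 0 s f' -> growth 0 s g' -> growth 0 s (fun x => f' x + g' x).
  move=> [cf [C fC] _] [cg [D gD] _]; split=> //.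
    by move=> x; exact: (continuousD (cf x) (cg x)).
  by exists (C + D) => x; rewrite (le_trans (ler_normD _ _))// mulrDl lerD.
elim: k f g => [|k IH] f g gf gg; first exact: g0.
apply: (@growthS _ _ _ (fun i x => partial i f x + partial i g x)).
- by apply: g0; apply: growth0; [exact: gf|exact: gg].
- by move=> i x; exact: (is_deriveD (growth_is_derive i x gf) (growth_is_derive i x gg)).
- by move=> i; apply: IH; exact: growth_partial.
Qed.

Lemma growthM k s s' f g : growth k s f -> growth k s' g ->
  growth k (s + s') (fun x => f x * g x).
Proof.
have g0 f' g' : growth 0 s f' -> growth 0 s' g' ->
    growth 0 (s + s') (fun x => f' x * g' x).
  move=> gf gg; split=> //.
    move=> x; exact: (cvgM (growth_continuous gf (x:=x)) (growth_continuous gg (x:=x))).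
  have [C C0 fC] := growth_bound gf; have [D D0 gD] := growth_bound gg.
  by exists (C * D) => x; rewrite normrM weight_powRD mulrACA ler_pM.
elim: k f g => [|k IH] f g gf gg; first exact: g0.
apply: (@growthS _ _ _ (fun i x => f x * partial i g x + g x * partial i f x)).
- by apply: g0; apply: growth0; [exact: gf|exact: gg].
- by move=> i x; exact: (is_deriveM (growth_is_derive i x gf) (growth_is_derive i x gg)).
- move=> i; apply: growthD.
    by apply: IH; [exact: growthW|exact: growth_partial].
  rewrite (_ : (fun _ => _) = (fun x => partial i f x * g x)).
    by apply: IH; [exact: growth_partial|exact: growthW].
  by apply/funext => x; rewrite mulrC.
Qed.

Lemma growthZ k s c f : growth k s f -> growth k s (fun x => c * f x).
Proof. by move=> /(growthM (growth_cst k c)); rewrite add0r. Qed.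

Lemma growth_coord k i : growth k 1 (fun x : V => x 0 i).
Proof.
have g0 : growth 0 1 (fun x : V => x 0 i).
  split=> //; first exact: coord_continuous.
  exists 1 => x; rewrite powRr1// mul1r (le_trans (coord_le_enorm _ _))//.
  by rewrite /weight lerDr.
case: k => [//|k]; apply: (@growthS _ _ _ (fun j _ => e j 0 i)) => //.
- by move=> j x; exact: is_derive_coord.
- by move=> j; apply: (@growth_le _ 0) => //; exact: growth_cst.
Qed.

(** The derivative of [v ^ (-p)] is [v ^ (-p-1)] times a derivative of [v]: the
    first factor gains two powers of the weight and the second loses one. This gain
    is recorded for the first derivative only; with [v] the solution, it is what
    makes the gradient of the density integrable. *)
Lemma growth_powR k (v : V -> R) (m p : R) : 0 < m -> 0 <= p -> continuous v ->
  (forall x, m * weight x `^ 2 <= v x) ->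
  (forall i x, derivable v x (e i)) -> (forall i, growth k 1 (partial i v)) ->
  growth k.+1 (- 2 * p) (fun x => v x `^ (- p)) /\
  forall i, growth k (- 2 * p - 1) (partial i (fun x => v x `^ (- p))).
Proof.
move=> m0 + cv vm dv; have v0 x : 0 < v x.
  by apply: lt_le_trans (vm x); rewrite mulr_gt0// powR_gt0.
have g0 p' : 0 <= p' -> growth 0 (- 2 * p') (fun x => v x `^ (- p')).
  move=> p0; split=> //; first by move=> x; exact: (cvg_powR _ (v0 x) (cv x)).
  exists (m `^ (- p')) => x; rewrite ger0_norm ?powR_ge0//.
  rewrite mulNr !powRN powRrM -invfM lef_pV2 ?posrE ?mulr_gt0 ?powR_gt0 ?powR_gt0//.
  rewrite -powRM ?powR_ge0 ?(ltW m0)//; apply: ge0_ler_powR; rewrite ?nnegrE ?(ltW (v0 x))//.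
  by rewrite mulr_ge0 ?powR_ge0// ltW.
have dp p' i x : is_derive x (e i) (fun x => v x `^ (- p'))
    (- p' * (v x `^ (- (p' + 1)) * partial i v x)).
  have := is_derive_powR (- p') (v0 x) (DeriveDef (dv i x) erefl).
  by rewrite -opprD mulrA.
have pE p' i : partial i (fun x => v x `^ (- p')) =
    (fun x => - p' * (v x `^ (- (p' + 1)) * partial i v x)).
  by apply/funext => x; have [_] := dp p' i x.
elim: k p => [|k IH] p p0 gv.
  have gp i : growth 0 (- 2 * p - 1)
      (fun x => - p * (v x `^ (- (p + 1)) * partial i v x)).
    rewrite (_ : - 2 * p - 1 = - 2 * (p + 1) + 1); last by ring.
    by apply: growthZ; apply: growthM => //; apply: g0; lra.
  split; last by move=> i; rewrite pE.
  apply: (growthS (g0 p p0) (dp p)) => i; apply: growth_le (gp i); lra.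
have [gp1 _] := IH (p + 1) ltac:(lra) (fun i => growthW (gv i)).
have gp i : growth k.+1 (- 2 * p - 1)
    (fun x => - p * (v x `^ (- (p + 1)) * partial i v x)).
  rewrite (_ : - 2 * p - 1 = - 2 * (p + 1) + 1); last by ring.
  by apply: growthZ; apply: growthM.
split; last by move=> i; rewrite pE.
apply: (growthS (g0 p p0) (dp p)) => i; apply: growth_le (gp i); lra.
Qed.

End growth.

(** * The kernel and its gradient *)

Section kernel.
Context {R : realType}.
Local Notation V := 'rV[R]_3.
Local Notation N := (@enorm R 3).
Local Notation w := weight.
Local Notation e i := (delta_mx 0 i : V).
Implicit Types (x y z : V) (i : 'I_3).

(** The [i]-th component of the gradient of the norm; it vanishes at the origin
    because division by zero does. *)
Definition unit_field i z : R := z 0 i / N z.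

Lemma unit_fieldE i z : unit_field i z * N z = z 0 i.
Proof.
have [->|z0] := eqVneq z 0; first by rewrite enorm0 mulr0 mxE.
by rewrite /unit_field divfK// gt_eqF// enorm_gt0.
Qed.

Lemma unit_field_le1 i z : `|unit_field i z| <= 1.
Proof.
have [->|z0] := eqVneq z 0; first by rewrite /unit_field mxE mul0r normr0.
have N0 := enorm_gt0 z0.
by rewrite /unit_field normrM normfV (gtr0_norm N0) ler_pdivrMr// mul1r coord_le_enorm.
Qed.

(** [unit_field] is odd and Lipschitz away from the origin, so this sum decays
    in [y]. *)
Lemma unit_fieldD_le i x y :
  `|unit_field i (x - y) + unit_field i y| <= 2 * w x * w y `^ (-1).
Proof.
have far : `|unit_field i (x - y) + unit_field i y| * N y <= 2 * N x.
  rewrite -[X in _ * X]ger0_norm ?enorm_ge0// -normrM.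
  have -> : (unit_field i (x - y) + unit_field i y) * N y =
      unit_field i (x - y) * (N y - N (x - y)) + x 0 i.
    rewrite mulrDl unit_fieldE mulrBr unit_fieldE !mxE; ring.
  apply: (le_trans (ler_normD _ _)).
  have dN : `|N y - N (x - y)| <= N x.
    by have := ler_enorm_dist y (y - x); rewrite opprB addrCA subrr addr0 (enormB x).
  have : `|unit_field i (x - y) * (N y - N (x - y))| <= N x.
    by rewrite normrM -[leRHS]mul1r ler_pM// unit_field_le1.
  by have := coord_le_enorm x i; lra.
have near : `|unit_field i (x - y) + unit_field i y| <= 2.
  have := unit_field_le1 i (x - y); have := unit_field_le1 i y.
  have := ler_normD (unit_field i (x - y)) (unit_field i y); lra.
rewrite powR_inv1 ?weight_ge0// ler_pdivlMr ?weight_gt0// /weight; lra.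
Qed.

Lemma cvg_unit_field i z : z != 0 -> {for z, continuous (unit_field i)}.
Proof.
move=> z0.
have c1 : {for z, continuous (fun z : V => z 0 i)} by exact: coord_continuous.
have c2 : {for z, continuous (fun z : V => (N z)^-1)}.
  exact: (cvgV (lt0r_neq0 (enorm_gt0 z0)) (@continuous_enorm _ _ z)).
exact: (cvgM c1 c2).
Qed.

Lemma enormB_sqr x y : N (x - y) ^+ 2 =
  N x ^+ 2 - 2 * (\sum_i x 0 i * y 0 i) + N y ^+ 2.
Proof.
rewrite !enorm_sqr mulr_sumr -sumrB -big_split/=.
by apply: eq_bigr => i _; rewrite !mxE; ring.
Qed.

Lemma enorm_step (t : R) i y :
  N (t *: e i + y) ^+ 2 = N y ^+ 2 + t * ((t *: e i + y) 0 i + y 0 i).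
Proof.
rewrite !enorm_sqr (bigD1 i)//= [in RHS](bigD1 i)//=.
rewrite (eq_bigr (fun j => y 0 j ^+ 2)).
  by rewrite !mxE !eqxx/= mulr1; ring.
by move=> j /negPf ji; rewrite !mxE eqxx/= ji mulr0 add0r.
Qed.

(** By [enorm_step], the difference quotient is a ratio of continuous functions. *)
Lemma is_derive_enorm i y : y != 0 -> is_derive y (e i) N (unit_field i y).
Proof.
move=> y0; have Ny := enorm_gt0 y0.
suff h : t^-1 *: (N (t *: e i + y) - N y) @[t --> (0 : R)^'] --> unit_field i y.
  by split; [exact: cvgP h|exact: cvg_lim h].
have line : (t *: e i + y) @[t --> (0 : R)^'] --> y.
  rewrite -[X in _ --> X]add0r -(scale0r (e i)); apply: cvgD; last exact: cvg_cst.
  by apply: cvgZr_tmp; apply: cvg_within; exact: cvg_id.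
have lim : ((t *: e i + y) 0 i + y 0 i) / (N (t *: e i + y) + N y)
    @[t --> (0 : R)^'] --> (y 0 i + y 0 i) / (N y + N y).
  apply: cvgM.
    apply: cvgD; last exact: cvg_cst.
    exact: (cvg_comp _ _ line (@coord_continuous _ _ _ 0 i y)).
  have NyNy : N y + N y != 0 by rewrite gt_eqF// addr_gt0.
  apply: (cvgV NyNy); apply: cvgD; last exact: cvg_cst.
  exact: (cvg_comp _ _ line (@continuous_enorm _ _ y)).
have -> : unit_field i y = (y 0 i + y 0 i) / (N y + N y).
  by rewrite /unit_field; field; rewrite gt_eqF//; lra.
apply: cvg_trans lim; apply: near_eq_cvg; near=> t.
have t0 : t != 0 by near: t; exact: nbhs_dnbhs_neq.
have := enorm_step t i y; have := enorm_ge0 (t *: e i + y).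
set a := N _; set b := N y in Ny *; set c := _ + y 0 i => a0 abc.
apply: (@mulIf _ (a + b)); first by rewrite gt_eqF//; lra.
rewrite divfK; last by rewrite gt_eqF//; lra.
apply: (mulfI t0); rewrite /GRing.scale/= mulrA mulrA mulfV// mul1r.
by transitivity (a ^+ 2 - b ^+ 2); [rewrite abc; ring|ring].
Unshelve. all: by end_near. Qed.

(** The distance from [x] to [y], minus its first-order Taylor polynomial in [x] at
    the origin. *)
Definition taylor_kernel x y : R :=
  N (x - y) - N y + \sum_i x 0 i * unit_field i y.
Local Notation K := taylor_kernel.

(** Multiplying by [N y] turns the dot product with the unit vector into the dot
    product with [y], which polarization expresses through norms. The sign and the
    size of the kernel can be read off. *)
Lemma taylor_kernelM x y :
  K x y * N y = (N x ^+ 2 - (N (x - y) - N y) ^+ 2) / 2.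
Proof.
rewrite /taylor_kernel mulrDl mulr_suml.
rewrite (eq_bigr (fun i => x 0 i * y 0 i)) => [|i _]; last first.
  by rewrite -mulrA unit_fieldE.
by have := enormB_sqr x y => h; nra.
Qed.

Lemma taylor_kernel_ge0 x y : 0 <= K x y.
Proof.
have [->|y0] := eqVneq y 0.
  rewrite /taylor_kernel subr0 enorm0 subr0 big1 ?addr0 ?enorm_ge0// => i _.
  by rewrite /unit_field mxE mul0r mulr0.
rewrite -(pmulr_lge0 _ (enorm_gt0 y0)) taylor_kernelM divr_ge0// subr_ge0.
have := ler_enorm_dist (y - x) y; rewrite addrAC subrr add0r enormN -(enormB x y) => h.
by rewrite -[leLHS]real_normK ?num_real// lerXn2r ?nnegrE ?enorm_ge0.
Qed.

Lemma taylor_kernel_le2 x y : K x y <= 2 * N x.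
Proof.
have h1 : N (x - y) - N y <= N x by have := ler_enormD x (- y); rewrite enormN; lra.
suff : \sum_i x 0 i * unit_field i y <= N x by rewrite /taylor_kernel; lra.
have [->|y0] := eqVneq y 0.
  rewrite big1 ?enorm_ge0// => i _.
  by rewrite /unit_field mxE mul0r mulr0.
rewrite -(ler_pM2r (enorm_gt0 y0)) mulr_suml.
rewrite (eq_bigr (fun i => x 0 i * y 0 i)) ?cauchy_schwarz// => i _.
by rewrite -mulrA unit_fieldE.
Qed.

Lemma taylor_kernel_le x y : K x y <= 2 * (1 + N x ^+ 2) * w y `^ (-1).
Proof.
rewrite powR_inv1 ?weight_ge0// ler_pdivlMr ?weight_gt0//.
have := taylor_kernelM x y; have := taylor_kernel_le2 x y.
have := sqr_ge0 (N (x - y) - N y); have := sqr_ge0 (N x - 1).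
rewrite /weight; nra.
Qed.

(** The difference quotient in direction [i] is a convex combination of the
    values at the two endpoints of the derivative of the kernel. *)
Lemma taylor_kernel_step (t : R) i x y : `|t| <= 1 ->
  `|K (t *: e i + x) y - K x y| <= `|t| * (4 * w x * w y `^ (-1)).
Proof.
move=> t1; set M := 4 * _ * _.
have M0 : 0 <= M by rewrite !mulr_ge0 ?powR_ge0 ?weight_ge0.
pose b := x - y; have ab : t *: e i + x - y = t *: e i + b by rewrite addrA.
have -> : K (t *: e i + x) y - K x y =
    N (t *: e i + b) - N b + t * unit_field i y.
  rewrite /taylor_kernel ab -/b.
  under eq_bigr do rewrite mxE mulrDl.
  rewrite big_split/= (bigD1 i)//= big1 => [|j /negPf ji]; last first.
    by rewrite !mxE eqxx/= ji mulr0 mul0r.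
  by rewrite !mxE !eqxx/= mulr1; ring.
have le x' : w x' <= 2 * w x -> `|unit_field i (x' - y) + unit_field i y| <= M.
  move=> x'x; apply: (le_trans (unit_fieldD_le _ _ _)).
  by apply: ler_wpM2r; [exact: powR_ge0|lra].
have wx := weight_ge1 x.
have hb : `|unit_field i b + unit_field i y| <= M by apply: le; lra.
have ha : `|unit_field i (t *: e i + b) + unit_field i y| <= M.
  rewrite -ab; apply: le; apply: (le_trans (weightM _ _)).
  apply: ler_wpM2r; first exact: weight_ge0.
  rewrite /weight enormZ enorm_delta; lra.
have [ab0|ab0] := eqVneq (N (t *: e i + b) + N b) 0.
  have a0 : N (t *: e i + b) = 0.
    by have := enorm_ge0 (t *: e i + b); have := enorm_ge0 b; lra.
  have b0 : N b = 0 by lra.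
  have t0 : t = 0.
    have := enorm_eq0 a0; rewrite (enorm_eq0 b0) addr0 => /rowP/(_ i).
    by rewrite !mxE !eqxx mulr1.
  by rewrite a0 b0 subr0 t0 mul0r addr0 normr0 mul0r.
have abp : 0 < N (t *: e i + b) + N b.
  by rewrite lt_neqAle eq_sym ab0 addr_ge0 ?enorm_ge0.
rewrite -(ler_pM2r abp) -[X in _ * X]gtr0_norm// -normrM.
have -> : (N (t *: e i + b) - N b + t * unit_field i y) * (N (t *: e i + b) + N b) =
    t * ((unit_field i (t *: e i + b) + unit_field i y) * N (t *: e i + b) +
      (unit_field i b + unit_field i y) * N b).
  rewrite 2![in RHS]mulrDl !unit_fieldE.
  have := enorm_step t i b; set A := N _; set B := N b; set c := _ 0 i => h.
  transitivity (A ^+ 2 - B ^+ 2 + t * unit_field i y * (A + B)); first by ring.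
  by rewrite h; ring.
rewrite normrM -mulrA ler_wpM2l//.
apply: (le_trans (ler_normD _ _)); rewrite !normrM.
rewrite (ger0_norm (enorm_ge0 _)) (ger0_norm (enorm_ge0 b)) mulrDr.
by apply: lerD; apply: ler_wpM2r => //; exact: enorm_ge0.
Qed.

Lemma is_derive_taylor_kernel i x y : y != x ->
  is_derive x (e i) (fun x => K x y) (unit_field i (x - y) + unit_field i y).
Proof.
move=> yx; have xy0 : x - y != 0 by rewrite subr_eq0 eq_sym.
have d1 := is_derive_reflect (is_derive_enorm i xy0).
have d2 : is_derive x (e i) (fun x : V => \sum_j x 0 j * unit_field j y)
    (unit_field i y).
  rewrite -(sum_delta (fun j => unit_field j y) i); apply: is_derive_sumr => j.
  have d := is_deriveM (is_derive_coord j x (e i)) (is_derive_cst (unit_field j y) x (e i)).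
  by apply: (is_derive_eq d); rewrite scaler0 add0r.
have := is_deriveD (is_deriveB d1 (is_derive_cst (N y) x (e i))) d2.
by rewrite subr0.
Qed.

Lemma continuous_taylor_kernel y : continuous (fun x => K x y).
Proof.
have cd : continuous (fun x => N (x - y)).
  move=> x; have c1 : (x' - y) @[x' --> x] --> x - y.
    exact: (cvgB cvg_id (cvg_cst _)).
  exact: (cvg_comp _ _ c1 (@continuous_enorm _ _ (x - y))).
have cs : continuous (fun x : V => \sum_i x 0 i * unit_field i y).
  apply: (@continuous_big _ _ +%R 0 xpredT); first exact: add_continuous.
  move=> i _ x.
  have c1 : {for x, continuous (fun z : V => z 0 i)} by exact: coord_continuous.
  exact: (cvgM c1 (cvg_cst _)).
by move=> x; exact: (cvgD (cvgB (cd x) (cvg_cst _)) (cs x)).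
Qed.

Lemma measurable_unit_field i : measurable3 (unit_field i).
Proof.
pose h n (z : V) : R := z 0 i / (N z + n.+1%:R^-1).
have h0 n z : 0 < N z + n.+1%:R^-1 by rewrite ltr_wpDl ?enorm_ge0// invr_gt0.
have ch n : continuous (h n).
  move=> z.
  have c1 : {for z, continuous (fun z : V => z 0 i)} by exact: coord_continuous.
  have c2 : {for z, continuous (fun z : V => (N z + n.+1%:R^-1)^-1)}.
    have c3 : {for z, continuous (fun z : V => N z + n.+1%:R^-1)}.
      exact: (cvgD (@continuous_enorm _ _ z) (cvg_cst _)).
    exact: (cvgV (lt0r_neq0 (h0 n z)) c3).
  exact: (cvgM c1 c2).
apply: (@measurable_fun_cvg _ _ _ _ (fun n => h n \o vec3)).
  by move=> n; exact: continuous_measurable3.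
move=> t _ /=; set z := vec3 t.
have [->|z0] := eqVneq z 0.
  rewrite /unit_field mxE mul0r; apply: cvg_near_cst; apply: nearW => n.
  by rewrite /h mxE mul0r.
apply: cvgM; first exact: cvg_cst.
apply: (cvgV (lt0r_neq0 (enorm_gt0 z0))).
rewrite -[X in _ --> X]addr0; apply: cvgD; first exact: cvg_cst.
apply/cvgrPdist_lt => r r0; have [n nP] := inv_lt_near r0.
by exists n => // m /nP; rewrite sub0r normrN ger0_norm.
Qed.

Lemma measurable_taylor_kernel x : measurable3 (taylor_kernel x).
Proof.
apply: measurable_funD.
  apply: (@continuous_measurable3 _ (fun y => N (x - y) - N y)) => y.
  have c1 : (x - y') @[y' --> y] --> x - y by exact: (cvgB (cvg_cst _) cvg_id).
  have c2 := cvg_comp _ _ c1 (@continuous_enorm _ _ (x - y)).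
  exact: (cvgB c2 (@continuous_enorm _ _ y)).
apply: measurable_sum => i; apply: measurable_funM; first exact: measurable_cst.
exact: measurable_unit_field.
Qed.

End kernel.

(** * Convolutions *)

Section convolution.
Context {R : realType}.
Local Notation V := 'rV[R]_3.
Local Notation I := (@integral3 R).
Local Notation w := weight.
Local Notation e i := (delta_mx 0 i : V).
Implicit Types (phi H : V -> R) (x v z : V).

Definition convolution phi H x := I (fun z => phi z * H (x - z)).

Lemma continuous_reflect H x : continuous H -> continuous (fun z => H (x - z)).
Proof.
move=> cH z; have c1 : (x - z') @[z' --> z] --> x - z by exact: (cvgB (cvg_cst _) cvg_id).
exact: (cvg_comp _ _ c1 (cH (x - z))).
Qed.

Lemma measurable_conv phi H x : measurable3 phi -> continuous H ->
  measurable3 (fun z => phi z * H (x - z)).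
Proof.
move=> mphi cH; apply: measurable_funM => //.
exact: (@continuous_measurable3 _ (fun z => H (x - z)) (continuous_reflect (x:=x) cH)).
Qed.

Lemma conv_le phi H a b C D x z : 0 <= C -> 0 <= D ->
  (forall z, `|phi z| <= C * w z `^ a) -> (forall z, `|H z| <= D * w z `^ b) ->
  `|phi z * H (x - z)| <= C * D * w x `^ `|b| * w z `^ (a + b).
Proof.
move=> C0 D0 phiC HD; rewrite normrM weight_powRD.
have -> : C * D * w x `^ `|b| * (w z `^ a * w z `^ b) =
    (C * w z `^ a) * (D * (w x `^ `|b| * w z `^ b)) by ring.
apply: ler_pM => //; apply: (le_trans (HD _)).
by apply: ler_wpM2l => //; exact: weight_powR_reflect.
Qed.

Lemma L1_weight_powR (a k : R) : a < -3 -> L1 (fun z : V => k * w z `^ a).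
Proof. by move=> a3; apply: L1Z; rewrite -[a]opprK; apply: L1_weight; lra. Qed.

Lemma L1_conv phi H a b C D x : 0 <= C -> 0 <= D -> a + b < -3 ->
  measurable3 phi -> (forall z, `|phi z| <= C * w z `^ a) ->
  continuous H -> (forall z, `|H z| <= D * w z `^ b) ->
  L1 (fun z => phi z * H (x - z)).
Proof.
move=> C0 D0 ab mphi phiC cH HD.
apply: (@L1_le _ _ (fun z => C * D * w x `^ `|b| * w z `^ (a + b))).
- exact: measurable_conv.
- by move=> z; exact: conv_le.
- exact: L1_weight_powR.
Qed.

Lemma convolutionC phi H x : L1 (fun z => phi z * H (x - z)) ->
  convolution phi H x = convolution H phi x.
Proof.
move=> /(integral3_reflect x) E; rewrite [LHS]/convolution -E.
apply: eq_integral3 => y.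
by rewrite opprB addrCA subrr addr0 mulrC.
Qed.

Lemma weight_near x : \forall x' \near x, w x' <= 2 * w x.
Proof.
have wx : w x < 2 * w x by have := weight_gt0 x; lra.
by have /cvgr_le/(_ _ wx) := @continuous_weight R x.
Qed.

Lemma near_powR_weight x (b : R) :
  \forall x' \near x, w x' `^ `|b| <= (2 * w x) `^ `|b|.
Proof.
apply: filterS (weight_near x) => x' x'x.
by apply: ge0_ler_powR; rewrite ?nnegrE ?mulr_ge0 ?weight_ge0.
Qed.

Lemma continuous_conv phi H a b : a + b < -3 -> measurable3 phi ->
  (exists2 C, 0 <= C & forall z, `|phi z| <= C * w z `^ a) -> growth 0 b H ->
  continuous (convolution phi H).
Proof.
move=> ab mphi [C C0 phiC] gH; have [D D0 HD] := growth_bound gH.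
have cH := growth_continuous gH; move=> x.
apply: (@continuous_integral3 _ (fun x z => phi z * H (x - z))
  (fun z => C * D * (2 * w x) `^ `|b| * w z `^ (a + b)) x 0).
- by move=> x'; exact: measurable_conv.
- exact: L1_weight_powR.
- apply: filterS (near_powR_weight x b) => x' x'x y.
  apply: (le_trans (conv_le _ _ C0 D0 phiC HD)).
  by rewrite ler_wpM2r ?powR_ge0// ler_wpM2l// mulr_ge0.
- move=> y _.
  have c1 : (x' - y) @[x' --> x] --> x - y by exact: (cvgB cvg_id (cvg_cst _)).
  exact: (cvgM (cvg_cst (phi y)) (cvg_comp _ _ c1 (cH (x - y)))).
Qed.

Lemma growth_increment_le H H' (b D t : R) i x z : 0 <= D ->
  (forall y, is_derive y (e i) H (H' y)) -> (forall y, `|H' y| <= D * w y `^ b) ->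
  `|H (t *: e i + x - z) - H (x - z)| <=
  `|t| * (D * (((1 + `|t|) * w x) `^ `|b| * w z `^ b)).
Proof.
move=> D0 dH H'D; rewrite -addrA; apply: mean_value_le; first by move=> y; have [] := dH y.
move=> s st; have [_ ->] := dH (s *: e i + (x - z)).
apply: (le_trans (H'D _)); apply: ler_wpM2l => //.
rewrite addrA; apply: (le_trans (weight_powR_reflect _ _ _)).
apply: ler_wpM2r; first exact: powR_ge0.
have t0 : 0 <= 1 + `|t| by rewrite addr_ge0.
apply: ge0_ler_powR; rewrite ?nnegrE ?mulr_ge0 ?weight_ge0//.
apply: (le_trans (weightM _ _)); apply: ler_wpM2r; first exact: weight_ge0.
by rewrite /weight enormZ enorm_delta mulr1 lerD2l.
Qed.

(** The increments of [H] are controlled by the mean value inequality, so [phi]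
    may be any measurable kernel; it will be the discontinuous [unit_field]. *)
Lemma is_derive_conv phi H a b i x : a + b < -3 -> measurable3 phi ->
  (exists2 C, 0 <= C & forall z, `|phi z| <= C * w z `^ a) -> growth 1 b H ->
  is_derive x (e i) (convolution phi H) (convolution phi (partial i H) x).
Proof.
move=> ab mphi [C C0 phiC] gH; have [D D0 HD] := growth_bound gH.
have cH := growth_continuous gH; have gH' := growth_partial i gH.
have [D' D'0 H'D] := growth_bound gH'; have cH' := growth_continuous gH'.
apply: (@is_derive_integral3 _ (fun x z => phi z * H (x - z)) _
  (fun z => C * D' * (2 * w x) `^ `|b| * w z `^ (a + b)) _ _ 0).
- by move=> t; exact: (L1_conv _ C0 D0 ab mphi phiC cH HD).
- exact: L1_weight_powR.
- exact: measurable_conv.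
- move=> t y t1; rewrite -mulrBr normrM.
  have -> : `|t| * (C * D' * (2 * w x) `^ `|b| * w y `^ (a + b)) =
      (C * w y `^ a) * (`|t| * (D' * ((2 * w x) `^ `|b| * w y `^ b))).
    by rewrite weight_powRD; ring.
  apply: ler_pM => //.
  apply: (le_trans (growth_increment_le t x y D'0
    (fun y => growth_is_derive i y gH) H'D)).
  rewrite ler_wpM2l// ler_wpM2l// ler_wpM2r ?powR_ge0//.
  apply: ge0_ler_powR; rewrite ?nnegrE ?mulr_ge0 ?weight_ge0 ?addr_ge0//.
  by apply: ler_wpM2r; [exact: weight_ge0|lra].
- move=> y _.
  have d1 := is_derive_reflect (growth_is_derive i (x - y) gH).
  have := is_deriveM (is_derive_cst (phi y) x (e i)) d1.
  by rewrite scaler0 addr0.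
Qed.

Lemma growth_conv k phi H (C s : R) : 3 < s -> 0 <= C ->
  measurable3 phi -> (forall z, `|phi z| <= C) ->
  growth k (- s) H -> growth k 0 (convolution phi H).
Proof.
move=> s3 C0 mphi phiC.
have phiC' : exists2 C, 0 <= C & forall z, `|phi z| <= C * w z `^ 0.
  by exists C => // z; rewrite powRr0 mulr1.
have s3' : 0 + - s < -3 by lra.
elim: k H => [|k IH] H gH.
  split=> //; first exact: (continuous_conv s3').
  have [D D0 HD] := growth_bound gH; have cH := growth_continuous gH.
  exists (C * D * I (fun z => w z `^ (- s))) => x; rewrite powRr0 mulr1.
  have Lw := L1_weight s3.
  rewrite -(integral3_reflect x Lw) -integral3Z; last exact: (L1_reflect x Lw).
  apply: le_norm_integral3.
  - exact: measurable_conv.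
  - by move=> z; rewrite normrM -mulrA ler_pM.
  - by apply: L1Z; exact: (L1_reflect x Lw).
apply: (@growthS _ _ _ _ (fun i => convolution phi (partial i H))).
- by apply: growth0; apply: IH; exact: growthW.
- move=> i x; apply: (@is_derive_conv phi H 0 (- s) i x s3' mphi phiC').
  by elim: (k) gH => // k' ih /growthW.
- by move=> i; apply: IH; exact: growth_partial.
Qed.

(** Both sides are the derivative of one convolution, written in its two forms. *)
Lemma convolution_by_parts phi H a b i x : a + b < -3 ->
  growth 1 a phi -> growth 1 b H ->
  convolution phi (partial i H) x = convolution (partial i phi) H x.
Proof.
move=> ab gphi gH.
have [C C0 phiC] := growth_bound gphi; have [D D0 HD] := growth_bound gH.
have [C' C'0 phiC'] := growth_bound (growth_partial i gphi).
have mphi := continuous_measurable3 (growth_continuous gphi).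
have mphi' := continuous_measurable3 (growth_continuous (growth_partial i gphi)).
have mH := continuous_measurable3 (growth_continuous gH).
have d1 := @is_derive_conv phi H a b i x ab mphi (ex_intro2 _ _ C C0 phiC) gH.
have ba : b + a < -3 by rewrite addrC.
have d2 := @is_derive_conv H phi b a i x ba mH (ex_intro2 _ _ D D0 HD) gphi.
have E : convolution phi H = convolution H phi.
  apply/funext => y; apply: convolutionC.
  exact: (L1_conv _ C0 D0 ab mphi phiC (growth_continuous gH) HD).
have [_ <-] := d1; rewrite E; have [_ ->] := d2; rewrite convolutionC//.
exact: (L1_conv _ D0 C'0 ba mH HD (growth_continuous (growth_partial i gphi)) phiC').
Qed.

End convolution.

(** * Potentials of decaying densities and the fixed point *)

Section potential.
Context {R : realType}.
Local Notation V := 'rV[R]_3.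
Local Notation I := (@integral3 R).
Local Notation w := weight.
Local Notation N := (@enorm R 3).
Local Notation K := taylor_kernel.
Implicit Types (f u v P : V -> R) (x y : V).

(** Otherwise [h] would vanish almost everywhere and the unit cube would be
    negligible. *)
Lemma integral3_gt0 (h : V -> R) : L1 h -> (forall y, 0 < h y) -> 0 < I h.
Proof.
move=> Lh h0; rewrite lt_neqAle integral3_ge0 ?andbT; last by move=> y; exact: ltW.
apply/eqP => I0.
have E : (\int[@volume R]_(t in [set: _]) `|(EFin \o (h \o vec3)) t| = 0)%E.
  under eq_integral do rewrite /= (ger0_norm (ltW (h0 _))).
  by rewrite -(fineK (integrable_fin_num measurableT Lh)); congr EFin; exact/esym.
have mh := measurable_int _ Lh.
have [A [mA A0 subA]] := (ae_eq_integral_abs _ measurableT mh).1 E.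
have {subA} AT t : A t.
  by apply: subA => /= /(_ Logic.I) [] ht; have := h0 (vec3 t); rewrite ht ltxx.
pose J : set (measurableTypeR R) := `[0, 1]%classic.
have mJ : measurable J by exact: measurable_itv.
have J1 : lebesgue_measure J = 1%E.
  by rewrite /J lebesgue_measure_itv/= lte_fin ltr01 oppr0 adde0.
have box1 : volume ((J `*` J) `*` J) = 1%E.
  have aJ : area (J `*` J) = 1%E.
    apply: (eq_trans (product_measure1E _ _ mJ mJ)).
    by apply: (eq_trans (congr2 (fun a b : \bar R => a * b)%E J1 J1)); rewrite mule1.
  apply: (eq_trans (product_measure1E _ _ (measurableX mJ mJ) mJ)).
  by apply: (eq_trans (congr2 (fun a b : \bar R => a * b)%E aJ J1)); rewrite mule1.
have : (volume ((J `*` J) `*` J) <= volume A)%E.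
  apply: le_measure; rewrite ?inE//.
  by apply: measurableX => //; exact: measurableX.
by rewrite box1 A0 lee_fin ler10.
Qed.

Definition potential f x := I (fun y => K x y * f y).

Section decaying_density.
Variables (q : R) (f : V -> R) (D : R).
Hypotheses (q1 : 1 < q) (mf : measurable3 f) (D0 : 0 <= D).
Hypothesis fD : forall y, `|f y| <= D * w y `^ (- 2 * q).

Lemma taylor_kernel_mul_le x y :
  `|K x y * f y| <= 2 * (1 + N x ^+ 2) * D * w y `^ (- (2 * q + 1)).
Proof.
rewrite normrM (ger0_norm (taylor_kernel_ge0 x y)).
rewrite (_ : - (2 * q + 1) = - 1 + - 2 * q); last by ring.
rewrite weight_powRD.
have -> : 2 * (1 + N x ^+ 2) * D * (w y `^ (-1) * w y `^ (- 2 * q)) =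
  (2 * (1 + N x ^+ 2) * w y `^ (-1)) * (D * w y `^ (- 2 * q)) by ring.
by apply: ler_pM => //; [exact: taylor_kernel_ge0|exact: taylor_kernel_le].
Qed.

Lemma measurable_potential x : measurable3 (fun y => K x y * f y).
Proof. by apply: measurable_funM => //; exact: measurable_taylor_kernel. Qed.

Lemma L1_decay : L1 (fun y : V => w y `^ (- (2 * q + 1))).
Proof. by apply: L1_weight; move: q1 => q1'; lra. Qed.

Lemma L1_potential x : L1 (fun y => K x y * f y).
Proof.
apply: (L1_le (measurable_potential x) (taylor_kernel_mul_le x)).
by apply: L1Z; exact: L1_decay.
Qed.

Lemma continuous_potential : continuous (potential f).
Proof.
move=> x; have Nx : N x < N x + 1 by lra.
apply: (@continuous_integral3 _ (fun x y => K x y * f y)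
  (fun y => 2 * (1 + (N x + 1) ^+ 2) * D * w y `^ (- (2 * q + 1))) x 0).
- exact: measurable_potential.
- by apply: L1Z; exact: L1_decay.
- have /cvgr_le/(_ _ Nx) := @continuous_enorm R 3 x; apply: filterS => x' x'x y.
  apply: (le_trans (taylor_kernel_mul_le x' y)).
  rewrite ler_wpM2r ?powR_ge0// ler_wpM2r// ler_wpM2l// lerD2l.
  by rewrite lerXn2r ?nnegrE ?addr_ge0 ?enorm_ge0.
- move=> y _; exact: (cvgM (@continuous_taylor_kernel R y x) (cvg_cst _)).
Qed.

End decaying_density.

Lemma powRN_lipschitz (q p a b : R) : 0 <= q -> 0 < p -> p <= a -> p <= b ->
  `|a `^ (- q) - b `^ (- q)| <= q * p `^ (- q - 1) * `|a - b|.
Proof.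
move=> q0 p0; wlog ab : a b / a <= b => [hw pa pb|pa pb].
  have [ab|/ltW ba] := leP a b; first exact: hw.
  by rewrite distrC [X in _ <= _ * X]distrC; exact: hw.
rewrite distrC [X in _ <= _ * X]distrC.
have d (t : R) : p <= t -> is_derive t 1 (fun t : R => t `^ (- q)) (- q * t `^ (- q - 1)).
  by move=> pt; apply: is_derive1_powR; exact: lt_le_trans pt.
have dab t : t \in `]a, b[ -> is_derive t 1 (fun t : R => t `^ (- q)) (- q * t `^ (- q - 1)).
  by rewrite in_itv/= => /andP[ta _]; apply: d; exact: (le_trans pa (ltW ta)).
have cab : {within `[a, b], continuous (fun t : R => t `^ (- q))}.
  apply: derivable_within_continuous => t; rewrite in_itv/= => /andP[ta _].
  by have [] := d t (le_trans pa ta).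
have [t tab ->] := MVT_segment ab dab cab.
have pt : p <= t by move: tab; rewrite in_itv/= => /andP[ta _]; exact: (le_trans pa ta).
rewrite normrM; apply: ler_wpM2r => //.
rewrite normrM normrN (ger0_norm q0) ger0_norm ?powR_ge0// ler_wpM2l//.
rewrite -opprD !powRN lef_pV2 ?posrE ?powR_gt0//; last exact: lt_le_trans pt.
by apply: ge0_ler_powR; rewrite ?nnegrE; lra.
Qed.

Lemma mulr_powRN1 (a q : R) : 0 < a -> a `^ (- q - 1) * a = a `^ (- q).
Proof.
move=> a0; rewrite -{2}(powRr1 (ltW a0)) -powRD ?subrK//.
by apply/implyP => _; rewrite gt_eqF.
Qed.

Lemma half_expr_le0 (a A : R) : (forall n, a <= A * 2^-1 ^+ n) -> a <= 0.
Proof.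
move=> aA; have h : A * 2^-1 ^+ n @[n --> \oo] --> A * 0.
  by apply: cvgM; [exact: cvg_cst|apply: cvg_expr; rewrite ger0_norm; lra].
rewrite mulr0 in h.
rewrite -[leRHS](cvg_lim _ h)//; apply: limr_ge.
  by apply/cvg_ex; exists 0.
exact: nearW.
Qed.

Section fixed_point.
Variables (q c D : R) (P : V -> R).
Hypotheses (q1 : 1 < q) (c0 : 0 <= c) (D0 : 0 <= D).
Hypotheses (cP : continuous P) (P0 : forall x, 0 < P x).
Hypothesis PD : forall x, P x `^ (- q) <= D * w x `^ (- 2 * q).
Hypothesis contr : forall x,
  c * (q * potential (fun y => P y `^ (- q)) x) <= P x / 2.

Let F u x := P x + c * potential (fun y => u y `^ (- q)) x.

Let powRN_le u y : P y <= u y -> u y `^ (- q) <= P y `^ (- q).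
Proof.
move=> Pu; have u0 := lt_le_trans (P0 y) Pu.
rewrite !powRN lef_pV2 ?posrE ?powR_gt0//.
by apply: ge0_ler_powR; rewrite ?nnegrE ?(ltW (P0 y)) ?(ltW u0)//; move: q1 => q1'; lra.
Qed.

Let density_le u y : (forall y, P y <= u y) -> `|u y `^ (- q)| <= D * w y `^ (- 2 * q).
Proof.
move=> Pu; rewrite ger0_norm ?powR_ge0//.
exact: (le_trans (powRN_le (Pu y))).
Qed.

Let measurable_density u : measurable3 u -> measurable3 (fun y => u y `^ (- q)).
Proof.
move=> mu; rewrite /measurable3.
by apply: (measurableT_comp (f := fun r : R => r `^ (- q)) (g := u \o vec3)).
Qed.

Let F_ge u x : P x <= F u x.
Proof.
rewrite lerDl mulr_ge0//; apply: integral3_ge0 => y.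
by rewrite mulr_ge0 ?powR_ge0 ?taylor_kernel_ge0.
Qed.

Let F_continuous u : measurable3 u -> (forall y, P y <= u y) -> continuous (F u).
Proof.
move=> mu Pu x; have mf := measurable_density mu.
have cpot := continuous_potential q1 mf D0 (fun y => density_le y Pu).
have c1 : {for x, continuous P} by exact: cP.
have c2 : {for x, continuous (fun x => c * potential (fun y => u y `^ (- q)) x)}.
  exact: (cvgM (cvg_cst c) (cpot x)).
exact: (cvgD c1 c2).
Qed.

(** All iterates are at least [P], where the slope of [t ^ (-q)] is at most
    [q * P ^ (-q-1)]. *)
Let F_contraction u v d : measurable3 u -> measurable3 v -> 0 <= d ->
  (forall y, P y <= u y) -> (forall y, P y <= v y) ->
  (forall y, `|u y - v y| <= d * P y) ->
  forall x, `|F u x - F v x| <= d / 2 * P x.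
Proof.
move=> mu mv d0 Pu Pv uv x.
have LK z : measurable3 z -> (forall y, P y <= z y) ->
    L1 (fun y => taylor_kernel x y * z y `^ (- q)).
  move=> mz Pz; apply: (@L1_potential q (fun y => z y `^ (- q)) D) => //.
    exact: measurable_density.
  by move=> y; exact: density_le.
have mP := continuous_measurable3 cP.
have Lu := LK u mu Pu; have Lv := LK v mv Pv; have LP := LK P mP (fun y => lexx _).
rewrite /F opprD addrACA subrr add0r -mulrBr normrM (ger0_norm c0).
rewrite -integral3B//.
apply: (@le_trans _ _ (c * (d * (q * potential (fun y => P y `^ (- q)) x)))).
  apply: ler_wpM2l => //.
  rewrite mulrA -integral3Z//; apply: le_norm_integral3.
  - exact: (measurable_funB (L1_measurable Lu) (L1_measurable Lv)).
  - move=> y; rewrite -mulrBr normrM (ger0_norm (taylor_kernel_ge0 _ _)).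
    rewrite [leRHS]mulrCA; apply: ler_wpM2l; first exact: taylor_kernel_ge0.
    have q0 : 0 <= q by move: q1 => q1'; lra.
    apply: (le_trans (powRN_lipschitz q0 (P0 y) (Pu y) (Pv y))).
    rewrite -(mulr_powRN1 q (P0 y)).
    have -> : d * q * (P y `^ (- q - 1) * P y) = q * P y `^ (- q - 1) * (d * P y) by ring.
    by apply: ler_wpM2l => //; rewrite mulr_ge0 ?powR_ge0.
  - exact: L1Z.
by rewrite mulrCA -mulrA [2^-1 * _]mulrC; apply: ler_wpM2l.
Qed.

Let u_ (n : nat) : V -> R := iter n F P.

Let u_ge n y : P y <= u_ n y.
Proof. by case: n => [|n]; [exact: lexx|exact: F_ge]. Qed.

Let u_continuous n : continuous (u_ n).
Proof.
elim: n => [//|n IH]; apply: F_continuous; first exact: continuous_measurable3.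
exact: u_ge.
Qed.

Let u_step n y : `|u_ n.+1 y - u_ n y| <= 2^-1 ^+ n * P y.
Proof.
elim: n y => [|n IH] y; last first.
  rewrite exprSr.
  have d0 : 0 <= 2^-1 ^+ n :> R by rewrite exprn_ge0// invr_ge0.
  exact: (F_contraction (continuous_measurable3 (@u_continuous n.+1))
    (continuous_measurable3 (@u_continuous n)) d0 (u_ge n.+1) (u_ge n) IH y).
rewrite expr0 mul1r /u_/= /F addrAC subrr add0r ger0_norm; last first.
  rewrite mulr_ge0//; apply: integral3_ge0 => z.
  by rewrite mulr_ge0 ?powR_ge0 ?taylor_kernel_ge0.
have pot0 : 0 <= c * potential (fun y => P y `^ (- q)) y.
  rewrite mulr_ge0//; apply: integral3_ge0 => z.
  by rewrite mulr_ge0 ?powR_ge0 ?taylor_kernel_ge0.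
have := contr y; rewrite mulrCA; have := P0 y; move: q1 => q1'; nra.
Qed.

(** Picard iteration for the contraction [F], in the norm weighted by [P]. The
    limit is only known to be measurable at first; it is continuous as a value of
    [F]. *)
Lemma potential_fixed_point : exists u, [/\ continuous u,
  (forall x, P x <= u x) &
  forall x, u x = P x + c * potential (fun y => u y `^ (- q)) x].
Proof.
(* the steps are at most [2 ^ (-n) * P], so these bounds are monotone in [n] *)
pose lo y n := u_ n y - 2 * 2^-1 ^+ n * P y.
pose hi y n := u_ n y + 2 * 2^-1 ^+ n * P y.
have half0 n : 0 <= 2^-1 ^+ n :> R by rewrite exprn_ge0// invr_ge0.
have loS y n : lo y n <= lo y n.+1.
  have := u_step n y; rewrite ler_norml => /andP[h _]; rewrite /lo exprS.
  rewrite (_ : 2 * (2^-1 * 2^-1 ^+ n) = 2^-1 ^+ n); last by field.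
  by lra.
have hiS y n : hi y n.+1 <= hi y n.
  have := u_step n y; rewrite ler_norml => /andP[_ h]; rewrite /hi exprS.
  rewrite (_ : 2 * (2^-1 * 2^-1 ^+ n) = 2^-1 ^+ n); last by field.
  by lra.
have lo_mono y m n : (m <= n)%N -> lo y m <= lo y n.
  by move=> /subnKC <-; elim: (n - m)%N => [|k IH]; [rewrite addn0|rewrite addnS (le_trans IH)].
have hi_mono y m n : (m <= n)%N -> hi y n <= hi y m.
  by move=> /subnKC <-; elim: (n - m)%N => [|k IH]; [rewrite addn0|rewrite addnS (le_trans _ IH)].
have lohi y m n : lo y m <= hi y n.
  apply: (le_trans (lo_mono y _ _ (leq_maxl m n))).
  apply: le_trans (hi_mono y _ _ (leq_maxr m n)).
  have h := mulr_ge0 (half0 (maxn m n)) (ltW (P0 y)).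
  by rewrite /lo /hi; lra.
pose u y := sup (range (lo y)).
have ulo y n : lo y n <= u y.
  apply: ub_le_sup; last by exists n.
  by exists (hi y 0%N) => _ [k _ <-]; exact: lohi.
have uhi y n : u y <= hi y n.
  apply: ge_sup; first by exists (lo y 0%N), 0%N.
  by move=> _ [k _ <-]; exact: lohi.
have uu n y : `|u_ n y - u y| <= 2 * 2^-1 ^+ n * P y.
  have := ulo y n; have := uhi y n; rewrite /lo /hi ler_norml => h1 h2.
  by apply/andP; split; lra.
have Pu y : P y <= u y.
  rewrite -subr_le0; apply: (@half_expr_le0 _ (2 * P y)) => n.
  by have := ulo y n; have := u_ge n y; rewrite /lo; lra.
have mu : measurable3 u.
  apply: (@measurable_fun_cvg _ _ _ _ (fun n => u_ n \o vec3)).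
    by move=> n; exact: (continuous_measurable3 (@u_continuous n)).
  move=> t _ /=; apply/cvgrPdist_le => r r0; set y := vec3 t.
  have h : 2 * P y * 2^-1 ^+ n @[n --> \oo] --> 2 * P y * 0.
    by apply: cvgM; [exact: cvg_cst|apply: cvg_expr; rewrite ger0_norm; lra].
  rewrite mulr0 in h; move/cvgr_le/(_ _ r0) : h; apply: filterS => n.
  by move=> hn; rewrite distrC (le_trans (uu n y))// mulrAC.
have uF y : u y = F u y.
  apply/eqP; rewrite -subr_eq0 -normr_le0.
  apply: (@half_expr_le0 _ (2 * P y)) => n.
  have d0 : 0 <= 2 * 2^-1 ^+ n :> R by rewrite mulr_ge0.
  have h1 := @F_contraction (u_ n) u _ (continuous_measurable3 (@u_continuous n)) mu
    d0 (u_ge n) Pu (uu n) y.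
  have h2 := uu n.+1 y; rewrite -[u_ n.+1]/(F (u_ n)) distrC in h2.
  have := ler_normD (u y - F (u_ n) y) (F (u_ n) y - F u y).
  rewrite addrA subrK => h3; apply: (le_trans h3).
  apply: (le_trans (lerD h2 h1)); rewrite exprS.
  have -> : 2 * (2^-1 * 2^-1 ^+ n) * P y + 2 * 2^-1 ^+ n / 2 * P y =
    2 * P y * 2^-1 ^+ n by field.
  by [].
exists u; split=> //; rewrite (_ : u = F u); last exact/funext.
exact: F_continuous.
Qed.

End fixed_point.
End potential.

(** * Regularity of the solution *)

Section shift_cancellation.
Context {R : realType}.
Local Notation V := 'rV[R]_3.
Local Notation I := (@integral3 R).
Local Notation w := weight.
Local Notation N := (@enorm R 3).

Let cutoff (n : nat) (y : V) : R := n.+1%:R / (n.+1%:R + N y).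

Let n1 (n : nat) : 1 <= n.+1%:R :> R. Proof. by rewrite ler1n. Qed.

Let cutoff_den n y : 0 < n.+1%:R + N y.
Proof. by rewrite ltr_pwDl ?enorm_ge0// ltr0n. Qed.

Let cutoff_ge0 n y : 0 <= cutoff n y.
Proof. by rewrite divr_ge0 ?ltW// cutoff_den. Qed.

Let cutoff_le1 n y : cutoff n y <= 1.
Proof. by rewrite ler_pdivrMr ?cutoff_den// mul1r lerDl enorm_ge0. Qed.

Let cutoff_le n y : cutoff n y <= n.+1%:R * w y `^ (-1).
Proof.
rewrite powR_inv1 ?weight_ge0//; apply: ler_wpM2l; first by rewrite ler0n.
by rewrite lef_pV2 ?posrE ?weight_gt0 ?cutoff_den// /weight lerD2r ?n1.
Qed.

Let cutoffB_le n a y : `|cutoff n (y - a) - cutoff n y| <= N a * w y `^ (-1).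
Proof.
have d1 := cutoff_den n (y - a); have d2 := cutoff_den n y.
have -> : cutoff n (y - a) - cutoff n y =
    cutoff n (y - a) * ((N y - N (y - a)) * (n.+1%:R + N y)^-1).
  move: d1 d2; rewrite /cutoff; move: (n.+1%:R : R) => p d1 d2.
  by field; rewrite !gt_eqF.
rewrite normrM (ger0_norm (cutoff_ge0 _ _)) -[leRHS]mul1r.
apply: ler_pM; [exact: cutoff_ge0|exact: normr_ge0|exact: cutoff_le1|].
rewrite normrM normfV (gtr0_norm d2); apply: ler_pM.
- exact: normr_ge0.
- by rewrite invr_ge0 ltW.
- by have := ler_enorm_dist y (y - a); rewrite opprB addrCA subrr addr0.
- rewrite powR_inv1 ?weight_ge0// lef_pV2 ?posrE ?weight_gt0//.
  by rewrite /weight lerD2r ?n1.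
Qed.

Let cutoff_cvg y : cutoff n y @[n --> \oo] --> (1 : R).
Proof.
apply/cvgrPdist_le => r r0.
have rN : 0 < r / (1 + N y) by rewrite divr_gt0// ltr_pwDl ?enorm_ge0.
have [n0 nP] := inv_lt_near rN; exists n0 => // n /nP /= nr.
have d := cutoff_den n y.
have -> : 1 - cutoff n y = N y / (n.+1%:R + N y).
  move: d; rewrite /cutoff; move: (n.+1%:R : R) => p d.
  by field; rewrite gt_eqF.
rewrite ger0_norm ?divr_ge0 ?enorm_ge0 ?(ltW d)//.
apply: (@le_trans _ _ (N y * n.+1%:R^-1)).
  apply: ler_wpM2l; first exact: enorm_ge0.
  by rewrite lef_pV2 ?posrE ?d ?ltr0n// lerDl enorm_ge0.
have N1 : 0 < 1 + N y by rewrite ltr_pwDl ?enorm_ge0.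
move: nr; rewrite ltr_pdivlMr// => nr; apply: le_trans (ltW nr).
rewrite mulrC; apply: ler_wpM2l; first by rewrite invr_ge0.
by rewrite lerDr.
Qed.

Let cutoff_continuous n : continuous (cutoff n).
Proof.
move=> y; have c1 : {for y, continuous (fun y : V => n.+1%:R + N y)}.
  exact: (cvgD (cvg_cst _) (@continuous_enorm _ _ y)).
exact: (cvgM (cvg_cst _) (cvgV (lt0r_neq0 (cutoff_den n y)) c1)).
Qed.

(** [F] may fail to be integrable. Multiplied by [cutoff n] it is, and the
    translation can then be moved to the cutoff, whose increment is
    [O (1 / weight)] uniformly in [n] and tends to zero. *)
Lemma integral3_increment (F : V -> R) (a : V) (C s : R) : 3 < s -> 0 <= C ->
  measurable3 F -> (forall y, `|F y| <= C * w y `^ (1 - s)) ->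
  L1 (fun y => F (y + a) - F y) -> I (fun y => F (y + a) - F y) = 0.
Proof.
move=> s3 C0 mF FC LF.
have mc n := continuous_measurable3 (@cutoff_continuous n).
have wS (y : V) : w y `^ (-1) * w y `^ (1 - s) = w y `^ (- s).
  by rewrite -weight_powRD; congr (_ `^ _); ring.
have lim1 : I (fun y => cutoff n y * (F (y + a) - F y)) @[n --> \oo] -->
    I (fun y => F (y + a) - F y).
  apply: (@dominated_integral3 _ (fun n y => cutoff n y * (F (y + a) - F y)) _
    (fun y => `|F (y + a) - F y|) 0).
  - by move=> n; exact: (measurable_funM (mc n) (L1_measurable LF)).
  - exact: L1_measurable.
  - move=> y _; rewrite -[X in _ --> X]mul1r; apply: cvgM; last exact: cvg_cst.
    exact: cutoff_cvg.
  - move=> n y; rewrite normrM (ger0_norm (cutoff_ge0 _ _)).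
    by rewrite ler_piMl.
  - exact: L1_norm.
have LcF n : L1 (fun y => cutoff n y * F y).
  apply: (@L1_le _ _ (fun y => n.+1%:R * C * w y `^ (- s))).
  - exact: (measurable_funM (mc n) mF).
  - move=> y; rewrite normrM (ger0_norm (cutoff_ge0 _ _)) -wS.
    have -> : n.+1%:R * C * (w y `^ (-1) * w y `^ (1 - s)) =
      (n.+1%:R * w y `^ (-1)) * (C * w y `^ (1 - s)) by ring.
    by apply: ler_pM.
  - by apply: L1Z; exact: L1_weight.
have LcFa n : L1 (fun y => cutoff n y * F (y + a)).
  have -> : (fun y => cutoff n y * F (y + a)) =
      (fun y => cutoff n y * (F (y + a) - F y) + cutoff n y * F y).
    by apply/funext => y; ring.
  apply: L1D => //; apply: (@L1_le _ _ (fun y => `|F (y + a) - F y|)).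
  - exact: (measurable_funM (mc n) (L1_measurable LF)).
  - by move=> y; rewrite normrM (ger0_norm (cutoff_ge0 _ _)) ler_piMl.
  - exact: L1_norm.
have E n : I (fun y => cutoff n y * (F (y + a) - F y)) =
    I (fun y => (cutoff n (y - a) - cutoff n y) * F y).
  transitivity (I (fun y => cutoff n y * F (y + a)) - I (fun y => cutoff n y * F y)).
    by rewrite -integral3B//; apply: eq_integral3 => y; rewrite mulrBr.
  rewrite -(integral3_shift (- a) (LcFa n)) -integral3B//; last first.
    exact: (L1_shift (- a) (LcFa n)).
  by apply: eq_integral3 => y; rewrite subrK mulrBl.
have lim0 : I (fun y => (cutoff n (y - a) - cutoff n y) * F y) @[n --> \oo] -->
    I (fun _ => 0).
  apply: (@dominated_integral3 _ (fun n y => (cutoff n (y - a) - cutoff n y) * F y) _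
    (fun y => N a * C * w y `^ (- s)) 0).
  - move=> n; apply: measurable_funM => //; apply: measurable_funB; last exact: mc.
    apply: (@continuous_measurable3 _ (fun y => cutoff n (y - a))) => y.
    have c1 : (y' - a) @[y' --> y] --> y - a by exact: (cvgB cvg_id (cvg_cst _)).
    exact: (cvg_comp _ _ c1 (@cutoff_continuous n (y - a))).
  - exact: measurable_cst.
  - move=> y _; rewrite -[X in _ --> X](mul0r (F y)); apply: cvgM; last exact: cvg_cst.
    by rewrite -[X in _ --> X](subrr (1 : R)); apply: cvgB; exact: cutoff_cvg.
  - move=> n y; rewrite normrM -wS.
    have -> : N a * C * (w y `^ (-1) * w y `^ (1 - s)) =
      (N a * w y `^ (-1)) * (C * w y `^ (1 - s)) by ring.
    by apply: ler_pM.
  - by apply: L1Z; exact: L1_weight.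
have I0 : I (fun _ => 0) = 0.
  by rewrite /integral3 /Rintegral integral0.
rewrite -I0 -(cvg_lim (@Rhausdorff R) lim1) -(cvg_lim (@Rhausdorff R) lim0).
by congr (lim (_ @ \oo)); apply/funext => n; exact: E.
Qed.

End shift_cancellation.

Section regularity.
Context {R : realType}.
Local Notation V := 'rV[R]_3.
Local Notation I := (@integral3 R).
Local Notation w := weight.
Local Notation N := (@enorm R 3).
Local Notation e i := (delta_mx 0 i : V).

Variables (q c m C : R) (coef : 'I_3 -> R) (u : V -> R).
Hypotheses (q1 : 1 < q) (m0 : 0 < m) (cu : continuous u).
Hypothesis um : forall x, m * w x `^ 2 <= u x.
Let f y := u y `^ (- q).
Hypothesis uE : forall x,
  u x = C + \sum_i coef i * x 0 i ^+ 2 + c * potential f x.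

Let u0 x : 0 < u x.
Proof. by apply: lt_le_trans (um x); rewrite mulr_gt0// powR_gt0. Qed.

Let cf : continuous f.
Proof. by rewrite /f => x; exact: (cvg_powR _ (u0 x) (@cu x)). Qed.

Let mf : measurable3 f. Proof. exact: continuous_measurable3. Qed.

Let D := m `^ (- q).

Let D0 : 0 <= D. Proof. exact: powR_ge0. Qed.

Let fD y : `|f y| <= D * w y `^ (- 2 * q).
Proof.
rewrite ger0_norm ?powR_ge0// /f /D mulNr !powRN powRrM -invfM.
rewrite lef_pV2 ?posrE ?mulr_gt0 ?powR_gt0 ?powR_gt0//.
rewrite -powRM ?powR_ge0 ?(ltW m0)//.
apply: ge0_ler_powR; rewrite ?nnegrE ?mulr_ge0 ?powR_ge0 ?(ltW (u0 y)) ?(ltW m0)//.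
by move: q1 => q1'; lra.
Qed.

(** The kernel is the gradient of [taylor_kernel] in [x]. *)
Let gradient_potential i x := I (fun y => (unit_field i (x - y) + unit_field i y) * f y).

Let L1w := L1_decay q1.

Let measurable_gradient i x :
  measurable3 (fun y => (unit_field i (x - y) + unit_field i y) * f y).
Proof.
apply: measurable_funM => //; apply: measurable_funD; last exact: measurable_unit_field.
have := measurable3_affine (-1) x (measurable_unit_field i).
rewrite /measurable3 /comp; under eq_fun do rewrite scaleN1r addrC.
exact.
Qed.

Let gradient_le i x y :
  `|(unit_field i (x - y) + unit_field i y) * f y| <=
  2 * w x * D * w y `^ (- (2 * q + 1)).
Proof.
rewrite normrM (_ : - (2 * q + 1) = - 1 + - 2 * q); last by ring.
rewrite weight_powRD.
have -> : 2 * w x * D * (w y `^ (-1) * w y `^ (- 2 * q)) =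
  (2 * w x * w y `^ (-1)) * (D * w y `^ (- 2 * q)) by ring.
by apply: ler_pM => //; exact: unit_fieldD_le.
Qed.

Let L1_gradient i x : L1 (fun y => (unit_field i (x - y) + unit_field i y) * f y).
Proof.
apply: (L1_le (measurable_gradient i x) (gradient_le i x)).
exact: L1Z.
Qed.

Let is_derive_potential i x :
  is_derive x (e i) (potential f) (gradient_potential i x).
Proof.
apply: (@is_derive_integral3 _ (fun x y => taylor_kernel x y * f y) _
  (fun y => 4 * w x * D * w y `^ (- (2 * q + 1))) _ _ x).
- by move=> t; exact: (@L1_potential R q f D q1 mf fD (t *: e i + x)).
- exact: L1Z.
- exact: measurable_gradient.
- move=> t y t1; rewrite -mulrBl normrM (_ : - (2 * q + 1) = - 1 + - 2 * q); last by ring.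
  rewrite weight_powRD.
  have -> : `|t| * (4 * w x * D * (w y `^ (-1) * w y `^ (- 2 * q))) =
    (`|t| * (4 * w x * w y `^ (-1))) * (D * w y `^ (- 2 * q)) by ring.
  by apply: ler_pM => //; exact: taylor_kernel_step.
- move=> y yx; have := is_deriveM (is_derive_taylor_kernel i yx)
    (is_derive_cst (f y) x (e i)).
  by rewrite scaler0 add0r => d; apply: (is_derive_eq d); rewrite [LHS]mulrC.
Qed.

Let is_derive_u i x :
  is_derive x (e i) u (2 * coef i * x 0 i + c * gradient_potential i x).
Proof.
have -> : u = (fun x => C + \sum_i coef i * x 0 i ^+ 2 + c * potential f x).
  exact/funext.
have d1 := is_deriveZ c (is_derive_potential i x).
have d2 := is_derive_diagonal_form coef i x.
have := is_deriveD (is_deriveD (is_derive_cst C x (e i)) d2) d1.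
by rewrite add0r.
Qed.

Let partial_u i : partial i u = (fun x => 2 * coef i * x 0 i + c * gradient_potential i x).
Proof. by apply/funext => x; have [_] := is_derive_u i x. Qed.

Let growth_gradient i : growth 0 1 (gradient_potential i).
Proof.
split=> //.
  move=> x; apply: (@continuous_integral3 _
    (fun x y => (unit_field i (x - y) + unit_field i y) * f y)
    (fun y => 2 * (2 * w x) * D * w y `^ (- (2 * q + 1))) x x).
  - exact: measurable_gradient.
  - exact: L1Z.
  - apply: filterS (weight_near x) => x' x'x y.
    apply: (le_trans (gradient_le i x' y)); apply: ler_wpM2r; first exact: powR_ge0.
    by apply: ler_wpM2r => //; lra.
  - move=> y yx; have xy0 : x - y != 0 by rewrite subr_eq0 eq_sym.
    have c1 : (x' - y) @[x' --> x] --> x - y by exact: (cvgB cvg_id (cvg_cst _)).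
    have c2 := cvg_comp _ _ c1 (cvg_unit_field (i := i) xy0).
    exact: (cvgM (cvgD c2 (cvg_cst _)) (cvg_cst (f y))).
exists (2 * D * I (fun y => w y `^ (- (2 * q + 1)))) => x.
rewrite powRr1// mulrAC [2 * D * w x]mulrAC -integral3Z//.
apply: le_norm_integral3; [exact: measurable_gradient|exact: gradient_le|exact: L1Z].
Qed.

Let growth_partial_u0 i : growth 0 1 (partial i u).
Proof.
rewrite partial_u; apply: growthD; last exact: growthZ.
by apply: growthZ; exact: growth_coord.
Qed.

Let growth_f k : (forall i, growth k 1 (partial i u)) ->
  growth k.+1 (- 2 * q) f /\ forall i, growth k (- 2 * q - 1) (partial i f).
Proof.
move=> gu; apply: (growth_powR m0) => //.
- by move: q1 => q1'; lra.
- by move=> i x; have [] := is_derive_u i x.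
Qed.

Let measurable_density x : measurable3 (fun z => f (x - z)).
Proof.
exact: (@continuous_measurable3 _ (fun z => f (x - z)) (continuous_reflect (x := x) (@cf))).
Qed.

(** The increment of the gradient, in which the kernel is shifted, is turned
    into an integral in which the density is. *)
Let gradient_increment i j x (t : R) :
  L1 (fun z => unit_field i z * (f (t *: e j + x - z) - f (x - z))) /\
  gradient_potential i (t *: e j + x) =
  gradient_potential i x +
  I (fun z => unit_field i z * (f (t *: e j + x - z) - f (x - z))).
Proof.
have [gf gf'] := growth_f growth_partial_u0.
have [D' D'0 f'D] := growth_bound (gf' j).
set a := t *: e j.
pose k z := unit_field i z * (f (a + x - z) - f (x - z)).
have mk : measurable3 k.
  apply: measurable_funM; first exact: measurable_unit_field.
  exact: (measurable_funB (measurable_density (a + x)) (measurable_density x)).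
have Lk : L1 k.
  apply: (@L1_le _ _ (fun z => `|t| * D' * ((1 + `|t|) * w x) `^ `|- 2 * q - 1| *
      w z `^ (- 2 * q - 1))) => // [z|].
    rewrite normrM; apply: (le_trans (ler_wpM2r (normr_ge0 _) (unit_field_le1 i z))).
    rewrite mul1r -!mulrA.
    exact: (growth_increment_le t x z D'0 (fun y => growth_is_derive j y gf) f'D).
  by apply: L1_weight_powR; move: q1 => q1'; lra.
split=> //; rewrite -[I _]/(I k).
pose h y := (unit_field i (a + x - y) - unit_field i (x - y)) * f y.
have hE y : h y = (unit_field i (a + x - y) + unit_field i y) * f y -
    (unit_field i (x - y) + unit_field i y) * f y by rewrite /h; ring.
have Lh : L1 h by rewrite (funext hE); exact: (L1B (L1_gradient _ _) (L1_gradient _ _)).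
have Ih : I h = gradient_potential i (a + x) - gradient_potential i x.
  rewrite (eq_integral3 hE).
  exact: (integral3B (L1_gradient i (a + x)) (L1_gradient i x)).
(* [Phi] is integrable only for [q > 3/2], but its increment always is *)
pose Phi z := unit_field i z * f (a + x - z).
have PhiE z : Phi (z + a) - Phi z = h (x - z) - k z.
  rewrite /Phi /h /k.
  have -> : a + x - (z + a) = x - z by rewrite opprD (addrC a) -addrA (addrCA a) subrr addr0.
  have -> : a + x - (x - z) = z + a by rewrite opprB -addrA (addrCA x) subrr addr0 addrC.
  by rewrite opprB addrCA subrr addr0; ring.
have LPhi : L1 (fun z => Phi (z + a) - Phi z).
  by rewrite (funext PhiE); exact: (L1B (L1_reflect x Lh) Lk).
have I0 : I (fun z => Phi (z + a) - Phi z) = 0.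
  apply: (@integral3_increment _ Phi a (D * w (a + x) `^ `|- 2 * q|) (2 * q + 1)) => //.
  - by move: q1 => q1'; lra.
  - by rewrite mulr_ge0 ?powR_ge0.
  - apply: measurable_funM; first exact: measurable_unit_field.
    exact: (measurable_density (a + x)).
  - move=> z; rewrite normrM (_ : 1 - (2 * q + 1) = - 2 * q); last by ring.
    apply: (le_trans (ler_wpM2r (normr_ge0 _) (unit_field_le1 i z))).
    rewrite mul1r -mulrA; apply: (le_trans (fD _)); apply: ler_wpM2l => //.
    exact: weight_powR_reflect.
move: I0; rewrite (eq_integral3 PhiE) (integral3B (L1_reflect x Lh) Lk).
rewrite (integral3_reflect x Lh) Ih; lra.
Qed.

Let is_derive_gradient i j x : is_derive x (e j) (gradient_potential i)
  (convolution (unit_field i) (partial j f) x).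
Proof.
have [gf gf'] := growth_f growth_partial_u0.
have [D' D'0 f'D] := growth_bound (gf' j).
pose A x' z := unit_field i z * (f (x' - z) - f (x - z)).
have dA : is_derive x (e j) (fun x' => I (A x'))
    (convolution (unit_field i) (partial j f) x).
  apply: (@is_derive_integral3 _ A _ (fun z => D' * (2 * w x) `^ `|- 2 * q - 1| *
      w z `^ (- 2 * q - 1)) _ _ 0).
  - by move=> t; have [] := gradient_increment i j x t.
  - by apply: L1_weight_powR; move: q1 => q1'; lra.
  - by apply: measurable_conv; [exact: measurable_unit_field|exact: growth_continuous (gf' j)].
  - move=> t z t1; rewrite /A subrr mulr0 subr0 normrM.
    apply: (le_trans (ler_wpM2r (normr_ge0 _) (unit_field_le1 i z))); rewrite mul1r.
    apply: (le_trans (growth_increment_le t x z D'0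
      (fun y => growth_is_derive j y gf) f'D)).
    rewrite -mulrA ler_wpM2l// ler_wpM2l// ler_wpM2r ?powR_ge0//.
    apply: ge0_ler_powR; rewrite ?nnegrE ?mulr_ge0 ?weight_ge0 ?addr_ge0//.
    by apply: ler_wpM2r; [exact: weight_ge0|lra].
  - move=> z _; have d1 := is_derive_reflect (growth_is_derive j (x - z) gf).
    have := is_deriveM (is_derive_cst (unit_field i z) x (e j))
      (is_deriveB d1 (is_derive_cst (f (x - z)) x (e j))).
    by rewrite scaler0 addr0 subr0.
(* only the restriction of the gradient to the line is known to be this integral *)
have x0 : 0 *: e j + x = x by rewrite scale0r add0r.
rewrite -[in X in is_derive X]x0; apply/is_derive_lineP.
have -> : (fun t : R => gradient_potential i (t *: e j + x)) =
    (fun t : R => gradient_potential i x + I (A (t *: e j + x))).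
  by apply/funext => t; have [_ ->] := gradient_increment i j x t.
have := is_derive_cst (gradient_potential i x) (0 : R) (1 : R).
move: dA; rewrite -[in X in is_derive X]x0 => /is_derive_lineP d1 d0.
by have := is_deriveD d0 d1; rewrite add0r.
Qed.

(** Bootstrap: [k] derivatives of the gradient of the solution give [k] derivatives
    of the gradient of the density, hence [k + 1] of the gradient of the
    solution. *)
Lemma growth_partial_solution k i : growth k 1 (partial i u).
Proof.
elim: k i => [//|k IH] i.
have [_ gf'] := growth_f IH.
rewrite partial_u; apply: growthD; first by apply: growthZ; exact: growth_coord.
apply: growthZ; apply: (growthS (growth_gradient i) (is_derive_gradient i)) => j.
apply: (@growth_le _ _ 0) => //.
apply: (@growth_conv _ _ _ _ 1 (2 * q + 1)) => //.
- by move: q1 => q1'; lra.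
- exact: measurable_unit_field.
- exact: unit_field_le1.
- by rewrite (_ : - (2 * q + 1) = - 2 * q - 1)//; ring.
Qed.

Lemma solution_C_k k : C_k k.+1 u.
Proof.
split=> // i; split; first by move=> x; have [] := is_derive_u i x.
exact: (growth_C_k (growth_partial_solution k i)).
Qed.

Lemma growth_density k : (growth k (- 2 * q) f) /\ forall i, growth k (- 2 * q - 1) (partial i f).
Proof.
have [gf gf'] := growth_f (growth_partial_solution k).
by split=> //; exact: growthW.
Qed.

Lemma second_partial_solution i j : partial j (partial i u) =
  (fun x => 2 * coef i * e j 0 i + c * convolution (unit_field i) (partial j f) x).
Proof.
apply/funext => x; rewrite partial_u.
have d1 := is_deriveZ (2 * coef i) (is_derive_coord i x (e j)).
have := is_deriveD d1 (is_deriveZ c (is_derive_gradient i j x)).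
by case.
Qed.

End regularity.

(** * The smoothed kernel *)

Section smooth_kernel.
Context {R : realType}.
Local Notation V := 'rV[R]_3.
Local Notation I := (@integral3 R).
Local Notation w := weight.
Local Notation N := (@enorm R 3).
Local Notation e i := (delta_mx 0 i : V).

Variable eps : R.
Hypotheses (eps0 : 0 < eps) (eps1 : eps <= 1).

Definition smooth_sqr (z : V) : R := eps ^+ 2 + N z ^+ 2.
Local Notation v := smooth_sqr.

Lemma smooth_sqr_gt0 z : 0 < v z.
Proof. by rewrite ltr_pwDl ?sqr_ge0// exprn_gt0. Qed.

Definition smooth_power (p : R) (z : V) : R := v z `^ (- p).
Local Notation a := smooth_power.

Lemma smooth_powerS p z : a (p + 1) z * v z = a p z.
Proof.
by rewrite /smooth_power (opprD p 1) mulr_powRN1 ?smooth_sqr_gt0.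
Qed.

Lemma is_derive_smooth_sqr i z : is_derive z (e i) v (2 * z 0 i).
Proof.
rewrite (_ : v = (fun z => eps ^+ 2 + \sum_j 1 * z 0 j ^+ 2)); last first.
  apply/funext => y; rewrite /smooth_sqr enorm_sqr; congr (_ + _).
  by apply: eq_bigr => j _; rewrite mul1r.
have := is_derive_diagonal_form (fun => 1) i z; rewrite mulr1 => d.
by have := is_deriveD (is_derive_cst (eps ^+ 2) z (e i)) d; rewrite add0r.
Qed.

Lemma is_derive_smooth_power p i z :
  is_derive z (e i) (a p) (- 2 * p * z 0 i * a (p + 1) z).
Proof.
have d := is_derive_powR (- p) (smooth_sqr_gt0 z) (is_derive_smooth_sqr i z).
by apply: (is_derive_eq d); rewrite /smooth_power (opprD p 1); ring.
Qed.

Lemma growth_smooth_power k p : 0 <= p -> growth k (- 2 * p) (a p).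
Proof.
move=> p0.
have cv : continuous v.
  move=> z; exact: (cvgD (cvg_cst _) (cvgM (@continuous_enorm _ _ z) (@continuous_enorm _ _ z))).
have vE i : partial i v = (fun z => 2 * z 0 i).
  by apply/funext => z; have [] := is_derive_smooth_sqr i z.
have m0 : 0 < eps ^+ 2 / 2 by rewrite divr_gt0// exprn_gt0.
have vm z : eps ^+ 2 / 2 * w z `^ 2 <= v z.
  rewrite powR_mulrn ?weight_ge0// /smooth_sqr /weight.
  have e2 : 0 <= eps ^+ 2 <= 1 by rewrite exprn_ge0 ?(ltW eps0)//= exprn_ile1 ?(ltW eps0).
  case/andP: e2; move: (eps ^+ 2) => E E0 E1.
  by have := enorm_ge0 z; have := sqr_ge0 (1 - N z); nra.
apply: growthW.
have [] // := growth_powR (k := k) m0 p0 cv vm.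
- by move=> i z; have [] := is_derive_smooth_sqr i z.
- by move=> i; rewrite vE; apply: growthZ; exact: growth_coord.
Qed.

(** A component of the gradient of [sqrt (eps ^ 2 + N z ^ 2)]. *)
Definition smooth_field (i : 'I_3) (z : V) : R := z 0 i * a 2^-1 z.

Lemma growth_smooth_field k i : growth k 0 (smooth_field i).
Proof.
rewrite (_ : 0 = 1 + - 2 * 2^-1); last by field.
by apply: growthM; [exact: growth_coord|apply: growth_smooth_power].
Qed.

(** The Laplacian of [smooth_field i]. *)
Definition smooth_lap_field (i : 'I_3) (z : V) : R :=
  - 2 * (z 0 i * a (3 / 2) z) - 3 * eps ^+ 2 * (z 0 i * a (5 / 2) z).

Lemma growth_smooth_lap_field k i : growth k (- 2) (smooth_lap_field i).
Proof.
have ga p : 3 / 2 <= p -> growth k (- 2) (fun z => z 0 i * a p z).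
  move=> p32; apply: (@growth_le _ _ (1 + - 2 * p)); first by lra.
  by apply: growthM; [exact: growth_coord|apply: growth_smooth_power; lra].
apply: growthD; first by apply: growthZ; apply: ga.
rewrite (_ : (fun z => _) = (fun z : V => (- (3 * eps ^+ 2)) * (z 0 i * a (5 / 2) z))).
  by apply: growthZ; apply: ga; lra.
by apply/funext => z; rewrite mulNr.
Qed.

Let half1 : 2^-1 + 1 = 3 / 2 :> R. Proof. by field. Qed.
Let half3 : 3 / 2 + 1 = 5 / 2 :> R. Proof. by field. Qed.
Let half5 : 5 / 2 + 1 = 7 / 2 :> R. Proof. by field. Qed.

Let is_derive_coord_power p i j z : is_derive z (e j) (fun z => z 0 i * a p z)
  (e j 0 i * a p z - 2 * p * z 0 i * z 0 j * a (p + 1) z).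
Proof.
have d := is_deriveM (is_derive_coord i z (e j)) (is_derive_smooth_power p j z).
by apply: (is_derive_eq d); rewrite /GRing.scale/=; ring.
Qed.

Let partial_smooth_field i j : partial j (smooth_field i) =
  (fun z => e j 0 i * a 2^-1 z - z 0 i * z 0 j * a (3 / 2) z).
Proof.
apply/funext => z; have [_ E] := is_derive_coord_power 2^-1 i j z.
rewrite /partial [LHS]E half1; by field.
Qed.

Lemma smooth_field_laplacian i z :
  \sum_j partial j (partial j (smooth_field i)) z = smooth_lap_field i z.
Proof.
have E j : partial j (partial j (smooth_field i)) z =
    - 2 * (e j 0 i * z 0 j) * a (3 / 2) z
    - z 0 i * a (3 / 2) z + 3 * z 0 i * (z 0 j ^+ 2) * a (5 / 2) z.
  rewrite partial_smooth_field.
  have d1 := is_deriveZ (e j 0 i) (is_derive_smooth_power 2^-1 j z).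
  have d2 := is_deriveM (is_derive_coord i z (e j)) (is_derive_coord_power (3 / 2) j j z).
  have E0 : (fun z => e j 0 i * a 2^-1 z - z 0 i * z 0 j * a (3 / 2) z) =
     (e j 0 i \*: a 2^-1) - (fun z : V => z 0 i) * (fun z => z 0 j * a (3 / 2) z).
    by apply/funext => y; rewrite -mulrA.
  rewrite E0 /partial; have [_ ->] := is_deriveB d1 d2.
  rewrite /GRing.scale/= half1 half3 !mxE !eqxx/=; by field.
rewrite (eq_bigr _ (fun j _ => E j)) !big_split/= -!mulr_suml -!mulr_sumr -enorm_sqr.
rewrite (bigD1 i)//= big1 => [|j /negPf ji]; last by rewrite mxE eq_sym ji mul0r.
rewrite mxE !eqxx/= sumr_const card_ord.
have := smooth_powerS (3 / 2) z; rewrite half3 /smooth_lap_field.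
have -> : N z ^+ 2 = v z - eps ^+ 2 by rewrite /smooth_sqr; ring.
move=> <-; ring.
Qed.

(** The norm is biharmonic away from the origin in dimension three, which is why
    nothing but a term in [eps ^ 4] remains. *)
Lemma smooth_lap_field_divergence z :
  \sum_i partial i (smooth_lap_field i) z = - (15 * eps ^+ 4 * a (7 / 2) z).
Proof.
have E i : partial i (smooth_lap_field i) z =
    - 2 * a (3 / 2) z - 3 * eps ^+ 2 * a (5 / 2) z +
    z 0 i ^+ 2 * (6 * a (5 / 2) z + 15 * eps ^+ 2 * a (7 / 2) z).
  have d1 := is_deriveZ (- 2) (is_derive_coord_power (3 / 2) i i z).
  have d2 := is_deriveZ (3 * eps ^+ 2) (is_derive_coord_power (5 / 2) i i z).
  have [_ h] := is_deriveB d1 d2; rewrite /partial [LHS]h.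
  by rewrite /GRing.scale/= half3 half5 !mxE !eqxx/=; by field.
rewrite (eq_bigr _ (fun j _ => E j)) !big_split/= -!mulr_suml -enorm_sqr.
rewrite !sumr_const card_ord.
have := smooth_powerS (3 / 2) z; rewrite half3.
have := smooth_powerS (5 / 2) z; rewrite half5.
have -> : N z ^+ 2 = v z - eps ^+ 2 by rewrite /smooth_sqr; ring.
move=> <- <-; ring.
Qed.

Variables (q : R) (f : V -> R).
Hypothesis q1 : 1 < q.
Hypothesis gf : forall k, growth k (- 2 * q) f.
Hypothesis gf' : forall k i, growth k (- 2 * q - 1) (partial i f).

Lemma L1_conv_growth (k k' : nat) (phi H : V -> R) (s s' : R) (x : V) : growth k s phi -> growth k' s' H ->
  s + s' < -3 -> L1 (fun z => phi z * H (x - z)).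
Proof.
move=> gphi gH ss'; have [C C0 phiC] := growth_bound gphi.
have [D D0 HD] := growth_bound gH.
have mphi := continuous_measurable3 (growth_continuous gphi).
exact: (L1_conv x C0 D0 ss' mphi phiC (growth_continuous gH) HD).
Qed.

(** Three integrations by parts: the two derivatives in direction [j] produce the
    Laplacian of [smooth_field], then the one in direction [i] its divergence. *)
Lemma smooth_bilaplacian x :
  \sum_j \sum_i convolution (smooth_field i) (partial j (partial j (partial i f))) x =
  - (15 * eps ^+ 4) * I (fun z => a (7 / 2) z * f (x - z)).
Proof.
have q1' := q1.
have byparts2 i j : convolution (smooth_field i) (partial j (partial j (partial i f))) x =
    convolution (partial j (partial j (smooth_field i))) (partial i f) x.
  rewrite (@convolution_by_parts _ _ _ 0 (- 2 * q - 1)); last 3 first.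
  - lra.
  - exact: growth_smooth_field.
  - exact: growth_partial (gf' 2 i).
  rewrite (@convolution_by_parts _ _ _ 0 (- 2 * q - 1))//.
  - lra.
  - exact: growth_partial (growth_smooth_field 2 i).
rewrite exchange_big/=.
have inner i : \sum_j convolution (smooth_field i) (partial j (partial j (partial i f))) x =
    convolution (partial i (smooth_lap_field i)) f x.
  rewrite (eq_bigr _ (fun j _ => byparts2 i j)) /convolution -integral3_sum; last first.
    move=> j; apply: (L1_conv_growth x (growth_partial j (growth_partial j (growth_smooth_field 2 i))) (gf' 0 i)).
    lra.
  transitivity (convolution (smooth_lap_field i) (partial i f) x).
    by apply: eq_integral3 => z; rewrite -mulr_suml smooth_field_laplacian.
  apply: (@convolution_by_parts _ _ _ (- 2) (- 2 * q)) => //; first lra.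
  exact: growth_smooth_lap_field.
rewrite (eq_bigr _ (fun i _ => inner i)) /convolution -integral3_sum; last first.
  move=> i; apply: (L1_conv_growth x (growth_partial i (growth_smooth_lap_field 1 i)) (gf 0)).
  lra.
rewrite -integral3Z.
  apply: eq_integral3 => z; rewrite -mulr_suml smooth_lap_field_divergence; ring.
apply: (L1_conv_growth x (growth_smooth_power 0 (p := 7 / 2) _) (gf 0)); lra.
Qed.

End smooth_kernel.

(** * The bilaplacian of the potential *)

Section bilaplacian_identity.
Context {R : realType}.
Local Notation V := 'rV[R]_3.
Local Notation I := (@integral3 R).
Local Notation w := weight.
Local Notation N := (@enorm R 3).
Local Notation e i := (delta_mx 0 i : V).

(** This number is [8 * pi]: the bilaplacian of the norm is minus this multiple of
    the Dirac mass at the origin. *)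
Definition biharmonic_mass : R := 15 * I (smooth_power 1 (7 / 2)).

Lemma L1_smooth_power1 : L1 (smooth_power (1 : R) (7 / 2)).
Proof.
have g := growth_smooth_power (ltr01 : 0 < 1 :> R) (lexx 1) 0 (p := 7 / 2).
have [|C C0 aC] := growth_bound (g _); first lra.
apply: (@L1_le _ _ (fun z => C * w z `^ (- 7))).
- apply: continuous_measurable3; apply: growth_continuous (g _); lra.
- by move=> z; apply: (le_trans (aC z)); rewrite (_ : - 2 * (7 / 2) = - 7)//; field.
- by apply: L1_weight_powR; lra.
Qed.

Lemma biharmonic_mass_gt0 : 0 < biharmonic_mass.
Proof.
rewrite mulr_gt0//; apply: integral3_gt0; first exact: L1_smooth_power1.
by move=> z; rewrite powR_gt0// smooth_sqr_gt0.
Qed.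

Let ep (n : nat) : R := n.+1%:R^-1.

Let ep0 n : 0 < ep n. Proof. by rewrite invr_gt0 ltr0n. Qed.

Let ep1 n : ep n <= 1. Proof. by rewrite invf_le1 ?ltr0n// ler1n. Qed.

Let ep_cvg : ep n @[n --> \oo] --> (0 : R).
Proof.
apply/cvgrPdist_lt => r r0; have [n nP] := inv_lt_near r0.
by exists n => // k /nP; rewrite sub0r normrN ger0_norm// ltW.
Qed.

Lemma smooth_field_le1 (eps : R) i (z : V) : 0 < eps -> `|smooth_field eps i z| <= 1.
Proof.
move=> eps0; have v0 := smooth_sqr_gt0 eps0 z.
rewrite /smooth_field /smooth_power powRN powR12_sqrt ?(ltW v0)//.
rewrite normrM normfV (ger0_norm (sqrtr_ge0 _)) ler_pdivrMr ?sqrtr_gt0// mul1r.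
apply: (le_trans (coord_le_enorm z i)).
rewrite -[leLHS]ger0_norm ?enorm_ge0// -sqrtr_sqr ler_sqrt ?(ltW v0)//.
by rewrite /smooth_sqr lerDr sqr_ge0.
Qed.

Let smooth_field_cvg i (z : V) :
  smooth_field (ep n) i z @[n --> \oo] --> unit_field i z.
Proof.
have [->|z0] := eqVneq z 0.
  rewrite /unit_field mxE mul0r; apply: cvg_near_cst; apply: nearW => n.
  by rewrite /smooth_field mxE mul0r.
have N0 := enorm_gt0 z0.
have vc : smooth_sqr (ep n) z @[n --> \oo] --> N z ^+ 2.
  rewrite -[X in _ --> X]add0r; apply: cvgD; last exact: cvg_cst.
  by rewrite -[X in _ --> X](mulr0 0); apply: cvgM.
have N2 : 0 < N z ^+ 2 by rewrite exprn_gt0.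
have -> : unit_field i z = z 0 i * (N z ^+ 2) `^ (- 2^-1).
  by rewrite powRN powR12_sqrt ?sqr_ge0// sqrtr_sqr ger0_norm ?enorm_ge0.
by apply: cvgM; [exact: cvg_cst|exact: (cvg_powR _ N2 vc)].
Qed.

(** On the smooth side, dilating by [eps] removes [eps] from the kernel and leaves
    it in the argument of [f] only. *)
Lemma bilaplacian_kernel (q : R) (f : V -> R) x : 1 < q ->
  (forall k, growth k (- 2 * q) f) ->
  (forall k i, growth k (- 2 * q - 1) (partial i f)) ->
  \sum_j \sum_i convolution (unit_field i) (partial j (partial j (partial i f))) x =
  - (biharmonic_mass * f x).
Proof.
move=> q1 gf gf'.
have lhs : \sum_j \sum_i
    convolution (smooth_field (ep n) i) (partial j (partial j (partial i f))) x
    @[n --> \oo] -->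
    \sum_j \sum_i convolution (unit_field i) (partial j (partial j (partial i f))) x.
  apply: (@cvg_big _ _ +%R 0 xpredT add_continuous) => j _.
  apply: (@cvg_big _ _ +%R 0 xpredT add_continuous) => i _.
  have gH : growth 0 (- 2 * q - 1) (partial j (partial j (partial i f))).
    exact: (growth_partial j (growth_partial j (gf' 2 i))).
  have [D D0 HD] := growth_bound gH; have cH := growth_continuous gH.
  have msf n : measurable3 (smooth_field (ep n) i).
    exact: (continuous_measurable3 (growth_continuous (growth_smooth_field (ep0 n) (ep1 n) 0 i))).
  apply: (@dominated_integral3 _ (fun n z => smooth_field (ep n) i z *
      partial j (partial j (partial i f)) (x - z)) _
    (fun z => D * (w x `^ `|- 2 * q - 1| * w z `^ (- 2 * q - 1))) 0).
  - by move=> n; exact: (measurable_conv x (msf n) cH).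
  - exact: (measurable_conv x (measurable_unit_field i) cH).
  - move=> z _; apply: cvgM; last exact: cvg_cst.
    exact: smooth_field_cvg.
  - move=> n z; rewrite normrM.
    apply: (le_trans (ler_wpM2r (normr_ge0 _) (smooth_field_le1 i z (ep0 n)))).
    rewrite mul1r; apply: (le_trans (HD _)); apply: ler_wpM2l => //.
    exact: weight_powR_reflect.
  - by apply: L1Z; apply: L1_weight_powR; lra.
have [D D0 fD] := growth_bound (gf 0); have cf := growth_continuous (gf 0).
have fD1 y : `|f y| <= D.
  apply: (le_trans (fD y)); rewrite -[leRHS]mulr1 ler_wpM2l//.
  by rewrite -[leRHS](powRr0 (w y)); apply: weight_powR_le; lra.
have mdil n : measurable3 (fun y => f (x - ep n *: y)).
  apply: (@continuous_measurable3 _ (fun y => f (x - ep n *: y))) => y.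
  have c0 : (ep n *: y') @[y' --> y] --> ep n *: y by exact: scaler_continuous.
  have c1 : (x - ep n *: y') @[y' --> y] --> x - ep n *: y by exact: (cvgB (cvg_cst _) c0).
  exact: (cvg_comp _ _ c1 (cf (x - ep n *: y))).
have scaled n : \sum_j \sum_i
    convolution (smooth_field (ep n) i) (partial j (partial j (partial i f))) x =
    - 15 * I (fun y => smooth_power 1 (7 / 2) y * f (x - ep n *: y)).
  rewrite (smooth_bilaplacian (ep0 n) (ep1 n) q1 gf gf').
  have Lh : L1 (fun z => smooth_power (ep n) (7 / 2) z * f (x - z)).
    have p0 : 0 <= 7 / 2 :> R by lra.
    apply: (L1_conv_growth x (growth_smooth_power (ep0 n) (ep1 n) 0 p0) (gf 0)).
    by lra.
  rewrite -(integral3_dilate (ep0 n) Lh).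
  have L1' : L1 (fun y => smooth_power 1 (7 / 2) y * f (x - ep n *: y)).
    apply: (@L1_le _ _ (fun y => D * smooth_power 1 (7 / 2) y)).
    - apply: measurable_funM; first exact: (L1_measurable L1_smooth_power1).
      exact: mdil.
    - by move=> y; rewrite normrM mulrC [`|smooth_power _ _ _|]ger0_norm ?powR_ge0// ler_wpM2r ?powR_ge0.
    - by apply: L1Z; exact: L1_smooth_power1.
  have hE y : smooth_power (ep n) (7 / 2) (ep n *: y) * f (x - ep n *: y) =
      ep n ^- 7 * (smooth_power 1 (7 / 2) y * f (x - ep n *: y)).
    rewrite mulrA; congr (_ * _).
    rewrite /smooth_power (_ : smooth_sqr (ep n) (ep n *: y) = ep n ^+ 2 * smooth_sqr 1 y).
      rewrite powRM ?sqr_ge0 ?(ltW (smooth_sqr_gt0 ltr01 y))//; congr (_ * _).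
      rewrite -powR_mulrn ?(ltW (ep0 n))// -powRrM -powR_invn ?(ltW (ep0 n))//.
      by congr (_ `^ _); field.
    rewrite /smooth_sqr enormZ (ger0_norm (ltW (ep0 n))) exprMn; ring.
  rewrite (eq_integral3 hE) integral3Z//.
  have := ep0 n; move: (ep n) => d d0; move: (I _) => J.
  by field; rewrite gt_eqF.
have rhs : - 15 * I (fun y => smooth_power 1 (7 / 2) y * f (x - ep n *: y))
    @[n --> \oo] --> - 15 * I (fun y => f x * smooth_power 1 (7 / 2) y).
  apply: cvgM; first exact: cvg_cst.
  apply: (@dominated_integral3 _
    (fun n y => smooth_power 1 (7 / 2) y * f (x - ep n *: y)) _
    (fun y => D * smooth_power 1 (7 / 2) y) 0).
  - move=> n; apply: measurable_funM; first exact: (L1_measurable L1_smooth_power1).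
    exact: mdil.
  - by apply: measurable_funM; [exact: measurable_cst|exact: (L1_measurable L1_smooth_power1)].
  - move=> y _; rewrite [X in _ --> X]mulrC; apply: cvgM; first exact: cvg_cst.
    have c1 : (x - ep n *: y) @[n --> \oo] --> x.
      rewrite -[X in _ --> X]subr0 -(scale0r y); apply: cvgB; first exact: cvg_cst.
      exact: cvgZr_tmp.
    exact: (cvg_comp _ _ c1 (cf x)).
  - by move=> n y; rewrite normrM mulrC [`|smooth_power _ _ _|]ger0_norm ?powR_ge0// ler_wpM2r ?powR_ge0.
  - by apply: L1Z; exact: L1_smooth_power1.
rewrite -(cvg_lim (@Rhausdorff R) lhs) (_ : (fun n => _) =
  (fun n => - 15 * I (fun y => smooth_power 1 (7 / 2) y * f (x - ep n *: y)))); last first.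
  by apply/funext => n; exact: scaled.
rewrite (cvg_lim (@Rhausdorff R) rhs) integral3Z; last exact: L1_smooth_power1.
by rewrite /biharmonic_mass; ring.
Qed.

End bilaplacian_identity.

(** * The solution and its asymptotic behaviour *)

Section solution.
Context {R : realType}.
Local Notation V := 'rV[R]_3.
Local Notation I := (@integral3 R).
Local Notation w := weight.
Local Notation N := (@enorm R 3).
Local Notation e i := (delta_mx 0 i : V).

Variables (q k1 k2 : R).
Hypotheses (q1 : 1 < q) (k10 : 0 < k1) (k12 : k1 < k2).

Definition axis_coef (i : 'I_3) : R := if i == 0 then k1 else k2.
Local Notation coef := axis_coef.

Definition quadratic (x : V) : R := \sum_i coef i * x 0 i ^+ 2.

Lemma quadratic_ge x : k1 * N x ^+ 2 <= quadratic x.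
Proof.
rewrite enorm_sqr mulr_sumr; apply: ler_sum => i _.
by apply: ler_wpM2r; [exact: sqr_ge0|rewrite /axis_coef; case: ifP => // _; exact: ltW].
Qed.

Lemma quadratic_ge0 x : 0 <= quadratic x.
Proof. by apply: le_trans (quadratic_ge x); rewrite mulr_ge0 ?sqr_ge0// ltW. Qed.

Lemma quadratic_le x : quadratic x <= k2 * N x ^+ 2.
Proof.
rewrite enorm_sqr mulr_sumr; apply: ler_sum => i _.
by apply: ler_wpM2r; [exact: sqr_ge0|rewrite /axis_coef; case: ifP => // _; exact: ltW].
Qed.

Lemma quadratic_step i (t : R) x :
  quadratic (t *: e i + x) = quadratic x + coef i * (t ^+ 2 + 2 * t * x 0 i).
Proof.
rewrite /quadratic (bigD1 i)//= [in RHS](bigD1 i)//=.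
rewrite (eq_bigr (fun j => coef j * x 0 j ^+ 2)) => [|j /negPf ji].
  by rewrite !mxE !eqxx/= mulr1; ring.
by rewrite !mxE eqxx/= ji mulr0 add0r.
Qed.

Lemma continuous_quadratic C : continuous (fun x => C + quadratic x).
Proof.
have cs : continuous quadratic.
  apply: (@continuous_big _ _ +%R 0 xpredT); first exact: add_continuous.
  move=> i _ x.
  have c1 : {for x, continuous (fun z : V => z 0 i)} by exact: coord_continuous.
  exact: (cvgM (cvg_cst _) (cvgM c1 c1)).
by move=> x; exact: (cvgD (cvg_cst C) (cs x)).
Qed.

Let m1 := Num.min 1 k1.

Let m10 : 0 < m1. Proof. by rewrite lt_min ltr01. Qed.

Let paraboloid_ge C x : 1 <= C -> m1 * (1 + N x ^+ 2) <= C + quadratic x.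
Proof.
move=> C1; have h1 : m1 <= 1 by rewrite ge_min lexx.
have h2 : m1 <= k1 by rewrite ge_min lexx orbT.
have := quadratic_ge x; have := sqr_ge0 (N x); nra.
Qed.

Let paraboloid_ge_weight C x : 1 <= C -> m1 / 2 * w x `^ 2 <= C + quadratic x.
Proof.
move=> /(paraboloid_ge x); apply: le_trans.
rewrite powR_mulrn ?weight_ge0// -mulrA ler_wpM2l ?(ltW m10)// /weight.
by have := sqr_ge0 (1 - N x); nra.
Qed.

(** The contraction constant tends to zero as the additive constant grows. *)
Let contraction_constant (c : R) : 0 <= c -> exists2 C, 1 <= C &
  forall x, c * (q * potential (fun y => (C + quadratic y) `^ (- q)) x) <=
            (C + quadratic x) / 2.
Proof.
move=> c0; pose d := (q - 1) / 2; pose q' := (q + 1) / 2.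
(* of the exponent [q = d + q'], [d] is spent on [C] and [q'] on convergence *)
have q1' := q1; have d0 : 0 < d by rewrite /d; lra.
have q'1 : 1 < q' by rewrite /q'; lra.
pose M := (m1 / 2) `^ (- q').
have M0 : 0 <= M by exact: powR_ge0.
pose J := I (fun y => w y `^ (- (2 * q' + 1))).
have J0 : 0 <= J by apply: integral3_ge0 => y; exact: powR_ge0.
pose A := c * q * 2 * M * J / m1.
have A0 : 0 <= A.
  have q0 : 0 <= q by lra.
  by rewrite divr_ge0 ?(ltW m10)// !mulr_ge0.
have [C C1 CA] : exists2 C, 1 <= C & A * C `^ (- d) <= 2^-1.
  exists ((1 + 2 * A) `^ d^-1).
    rewrite -[leLHS](powRr0 (1 + 2 * A)); apply: ler_powR; first lra.
    by rewrite invr_ge0 ltW.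
  rewrite powRN -powRrM mulVf ?gt_eqF// powRr1; last lra.
  by rewrite ler_pdivrMr; lra.
have C0 : 0 < C by lra.
exists C => // x; set P := C + quadratic x.
have P0 y : 0 < C + quadratic y.
  by have := quadratic_ge0 y; lra.
have bound y : `|(C + quadratic y) `^ (- q)| <= C `^ (- d) * M * w y `^ (- 2 * q').
  rewrite ger0_norm ?powR_ge0//.
  have -> : - q = - d + - q' by rewrite /d /q'; field.
  rewrite powRD; last by apply/implyP => _; rewrite gt_eqF.
  rewrite -mulrA; apply: ler_pM; rewrite ?powR_ge0//.
    rewrite !powRN lef_pV2 ?posrE ?powR_gt0//.
    apply: ge0_ler_powR; rewrite ?nnegrE ?(ltW (P0 y)) ?(ltW C0) ?(ltW d0)//.
    by have := quadratic_ge0 y; lra.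
  have -> : - 2 * q' = 2 * - q' by ring.
  rewrite powRrM -powRM ?powR_ge0//; last by rewrite divr_ge0 ?(ltW m10).
  rewrite !powRN lef_pV2 ?posrE ?powR_gt0 ?mulr_gt0 ?powR_gt0 ?weight_gt0 ?invr_gt0//.
  apply: ge0_ler_powR; rewrite ?nnegrE ?(ltW (P0 y)) ?mulr_ge0 ?powR_ge0 ?(ltW m10)//.
    by lra.
  exact: paraboloid_ge_weight.
have mP : measurable3 (fun y => (C + quadratic y) `^ (- q)).
  apply: continuous_measurable3 => y.
  exact: (cvg_powR _ (P0 y) (@continuous_quadratic C y)).
have pot : potential (fun y => (C + quadratic y) `^ (- q)) x <=
    2 * (1 + N x ^+ 2) * (C `^ (- d) * M) * J.
  rewrite -integral3Z; last exact: (L1_decay q'1).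
  apply: le_integral3.
  - exact: (L1_potential q'1 mP bound).
  - by apply: L1Z; exact: (L1_decay q'1).
  - move=> y; apply: (le_trans (ler_norm _)).
    exact: (taylor_kernel_mul_le bound).
have Px : (1 + N x ^+ 2) <= P / m1 by rewrite ler_pdivlMr// mulrC paraboloid_ge.
apply: (@le_trans _ _ (c * (q * (2 * (P / m1) * (C `^ (- d) * M) * J)))).
  have q0 : 0 <= q by lra.
  rewrite ler_wpM2l// ler_wpM2l//; apply: (le_trans pot).
  rewrite ler_wpM2r// ler_wpM2r ?mulr_ge0 ?powR_ge0//.
  by rewrite ler_wpM2l.
have -> : c * (q * (2 * (P / m1) * (C `^ (- d) * M) * J)) = P * (A * C `^ (- d)).
  by rewrite /A; field; rewrite gt_eqF.
by apply: ler_wpM2l => //; exact: (ltW (P0 x)).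
Qed.

Local Notation c := ((biharmonic_mass (R := R))^-1).

Lemma solution_exists : exists C u, [/\ 1 <= C, continuous u,
  forall x, C + quadratic x <= u x &
  forall x, u x = C + quadratic x + c * potential (fun y => u y `^ (- q)) x].
Proof.
have c0 : 0 <= c by rewrite invr_ge0 ltW// biharmonic_mass_gt0.
have [C C1 HC] := contraction_constant c0.
have P0 y : 0 < C + quadratic y.
  by have := quadratic_ge0 y; lra.
have m0 : 0 < m1 / 2 by rewrite divr_gt0.
have PD y : (C + quadratic y) `^ (- q) <= (m1 / 2) `^ (- q) * w y `^ (- 2 * q).
  have -> : - 2 * q = 2 * - q by ring.
  rewrite powRrM -powRM ?powR_ge0 ?(ltW m0)//.
  rewrite !powRN lef_pV2 ?posrE ?powR_gt0 ?mulr_gt0 ?powR_gt0 ?weight_gt0 ?invr_gt0//.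
  apply: ge0_ler_powR; rewrite ?nnegrE ?(ltW (P0 y)) ?mulr_ge0 ?powR_ge0 ?(ltW m10)//.
    by have := q1; lra.
  exact: paraboloid_ge_weight.
have [u [cu Pu uE]] := potential_fixed_point q1 c0 (powR_ge0 _ _)
  (@continuous_quadratic C) P0 PD HC.
by exists C, u.
Qed.

Section properties.
Variables (C : R) (u : V -> R).
Hypotheses (C1 : 1 <= C) (cu : continuous u).
Hypothesis Pu : forall x, C + quadratic x <= u x.
Hypothesis uE : forall x,
  u x = C + quadratic x + c * potential (fun y => u y `^ (- q)) x.
Local Notation f := (fun y => u y `^ (- q)).

Let m0 : 0 < m1 / 2. Proof. by rewrite divr_gt0. Qed.

Let um x : m1 / 2 * w x `^ 2 <= u x.
Proof. by apply: le_trans (Pu x); exact: paraboloid_ge_weight. Qed.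

Lemma solution_gt0 x : 0 < u x.
Proof.
by apply: lt_le_trans (Pu x); have := quadratic_ge0 x; have := C1; lra.
Qed.

Let gf k : growth k (- 2 * q) f.
Proof. by have [] := growth_density q1 m0 cu um uE k. Qed.

Let gf' k i : growth k (- 2 * q - 1) (partial i f).
Proof. by have [] := growth_density q1 m0 cu um uE k. Qed.

Let partial_conv i H : growth 1 (- 2 * q - 1) H ->
  forall j x, is_derive x (e j) (convolution (unit_field i) H)
    (convolution (unit_field i) (partial j H) x).
Proof.
move=> gH j x; apply: (@is_derive_conv _ _ _ 0 (- 2 * q - 1)) => //.
- by have := q1; lra.
- exact: measurable_unit_field.
- by exists 1 => // z; rewrite powRr0 mulr1 unit_field_le1.
Qed.

Lemma solution_bilaplacian x : bilaplacian u x = - u x `^ (- q).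
Proof.
have lapE : laplacian u = (fun x =>
    \sum_i (2 * coef i + c * convolution (unit_field i) (partial i f) x)).
  apply/funext => y; apply: eq_bigr => i _.
  by rewrite (second_partial_solution q1 m0 cu um uE) mxE !eqxx mulr1.
have dsum (F : 'I_3 -> V -> R) (a : 'I_3 -> R) (b : R) H j :
    (forall i x, F i x = a i + b * convolution (unit_field i) (H i) x) ->
    (forall i, growth 1 (- 2 * q - 1) (H i)) ->
    partial j (fun x => \sum_i F i x) =
    (fun x => \sum_i b * convolution (unit_field i) (partial j (H i)) x).
  move=> FE gH; apply/funext => y.
  have dF i : is_derive y (e j) (F i) (b * convolution (unit_field i) (partial j (H i)) y).
    rewrite (_ : F i = (fun x => a i + b * convolution (unit_field i) (H i) x)); last exact/funext.
    have := is_deriveD (is_derive_cst (a i) y (e j)) (is_deriveZ b (partial_conv i (gH i) j y)).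
    by rewrite add0r.
  by have [] := is_derive_sumr dF.
have E j : partial j (partial j (laplacian u)) = (fun x =>
    \sum_i c * convolution (unit_field i) (partial j (partial j (partial i f))) x).
  rewrite lapE (@dsum _ (fun i => 2 * coef i) c (fun i => partial i f))//.
  rewrite (@dsum _ (fun i => 0) c (fun i => partial j (partial i f)))// => i.
    by move=> y; rewrite add0r.
  exact: (growth_partial j (gf' 2 i)).
rewrite /bilaplacian {1}/laplacian.
under eq_bigr do rewrite E -mulr_sumr.
rewrite -mulr_sumr (bilaplacian_kernel x q1 gf gf') mulrN mulKf//.
by rewrite gt_eqF// biharmonic_mass_gt0.
Qed.

Lemma solution_entire : entire_positive_solution q u.
Proof.
split; first exact: (solution_C_k q1 m0 cu um uE 3).
- exact: solution_gt0.
- by move=> x; rewrite solution_bilaplacian addNr.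
Qed.

Lemma enorm_infty_gt (M : R) : enorm_infty 3 [set x : V | M < N x].
Proof. by exists M. Qed.

(** After division by [N x ^ 2] the kernel is at most [4 / weight y], which
    dominates, and at most [2 / N x], which tends to zero. *)
Lemma potential_littleo :
  N x ^- 2 * potential f x @[x --> enorm_infty 3] --> (0 : R).
Proof.
have [D D0 fD] := growth_bound (gf 0).
have mf : measurable3 f by exact: (continuous_measurable3 (growth_continuous (gf 0))).
have -> : (fun x => N x ^- 2 * potential f x) =
    (fun x => I (fun y => N x ^- 2 * (taylor_kernel x y * f y))).
  apply/funext => x; rewrite integral3Z//.
  exact: (L1_potential q1 mf fD).
have -> : 0 = I (fun _ => 0) by rewrite /integral3 /Rintegral integral0.
apply: (@cvg_integral3 _ _ _ _ (fun x y => N x ^- 2 * (taylor_kernel x y * f y)) _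
  (fun y => 4 * D * w y `^ (- (2 * q + 1))) 0).
- exact: countably_based_infty.
- move=> x; apply: measurable_funM; first exact: measurable_cst.
  exact: (measurable_potential mf x).
- exact: measurable_cst.
- by apply: L1Z; exact: (L1_decay q1).
- apply: filterS (enorm_infty_gt 1) => x /= Nx y.
  have N2 : 0 < N x ^+ 2 by rewrite exprn_gt0//; lra.
  rewrite normrM normfV (ger0_norm (ltW N2)) ler_pdivrMl//.
  apply: (le_trans (taylor_kernel_mul_le fD x y)).
  rewrite !mulrA ler_wpM2r ?powR_ge0// ler_wpM2r//; nra.
- move=> y _; apply/cvgrPdist_le => r r0.
  apply: filterS (enorm_infty_gt (2 * `|f y| / r + 1)) => x /= Nx.
  have fy0 : 0 <= 2 * `|f y| / r by rewrite divr_ge0 ?mulr_ge0// ltW.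
  have Nx0 : 0 < N x by lra.
  rewrite sub0r normrN !normrM normfV (ger0_norm (sqr_ge0 _)).
  rewrite (ger0_norm (taylor_kernel_ge0 _ _)) ler_pdivrMl ?exprn_gt0//.
  apply: (le_trans (ler_wpM2r (normr_ge0 _) (taylor_kernel_le2 x y))).
  have : 2 * `|f y| <= r * N x by rewrite -ler_pdivrMl// mulrC; lra.
  by move=> h; rewrite expr2; have := ler_wpM2r (ltW Nx0) h; nra.
Qed.

Lemma solution_near_quadratic (d : R) : 0 < d ->
  \forall x \near enorm_infty 3, u x <= quadratic x + d * N x ^+ 2.
Proof.
move=> d0; have lim : c * (N x ^- 2 * potential f x) @[x --> enorm_infty 3] --> c * 0.
  by apply: cvgM; [exact: cvg_cst|exact: potential_littleo].
rewrite mulr0 in lim; have d20 : 0 < d / 2 by lra.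
apply: filterS2 (cvgr_le _ lim _ d20) (enorm_infty_gt (1 + 2 * C / d)) => x h /= Nx.
have Cd : 0 <= 2 * C / d by rewrite divr_ge0 ?(ltW d0)// mulr_ge0//; have := C1; lra.
have N1 : 1 < N x by lra.
have N2 : 0 < N x ^+ 2 by rewrite exprn_gt0//; lra.
have CN : C <= d / 2 * N x ^+ 2.
  have : 2 * C <= d * N x by rewrite -ler_pdivrMl// mulrC; lra.
  have dN : 0 <= d * N x * (N x - 1).
    by rewrite mulr_ge0 ?mulr_ge0 ?enorm_ge0 ?(ltW d0)//; lra.
  by move=> hC; rewrite expr2; lra.
move: h; rewrite mulrCA mulrC ler_pdivrMr// => h.
by rewrite uE; lra.
Qed.

Lemma quadratic_axis i (t : R) : quadratic (t *: e i) = coef i * t ^+ 2.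
Proof.
have := quadratic_step i t 0; rewrite addr0 => ->.
rewrite /quadratic big1 ?add0r => [|j _]; last by rewrite mxE expr0n mulr0.
by rewrite mxE mulr0 addr0.
Qed.

Lemma enorm_axis i (t : R) : N (t *: e i) = `|t|.
Proof. by rewrite enormZ enorm_delta mulr1. Qed.

Lemma axis_in_nbhs_infty i (A : set V) : enorm_infty 3 A ->
  exists2 t : R, 0 < t & A (t *: e i).
Proof.
move=> [M _ MA]; exists (`|M| + 1); first by rewrite ltr_wpDl.
apply: MA => /=; rewrite enorm_axis.
have := ler_norm M; have := normr_ge0 M => M0 MM.
by rewrite ger0_norm; lra.
Qed.

Let ratio x := u x / N x ^+ 2.

Let ratio_ge i t : 0 < t -> coef i <= ratio (t *: e i).
Proof.
move=> t0; rewrite /ratio ler_pdivlMr enorm_axis (gtr0_norm t0) ?exprn_gt0//.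
rewrite -quadratic_axis; apply: le_trans (Pu _); have := C1; lra.
Qed.

(** The lower bound holds everywhere since the potential is nonnegative; along the
    axis [0] it is attained in the limit. *)
Lemma solution_liminf :
  limf_einf (fun x => (u x / N x ^+ 2)%:E) (enorm_infty 3) = k1%:E.
Proof.
rewrite limf_einfE; apply/eqP; rewrite eq_le; apply/andP; split.
  apply: ge_ereal_sup => _ [A FA <-].
  apply/lee_addgt0Pr => d d0.
  have [t t0 [/= At ut]] := axis_in_nbhs_infty 0 (filterI FA (solution_near_quadratic d0)).
  apply: (@le_trans _ _ (ratio (t *: e 0))%:E).
    by apply: ereal_inf_lbound; exists (t *: e 0).
  rewrite -EFinD lee_fin /ratio ler_pdivrMr enorm_axis (gtr0_norm t0) ?exprn_gt0//.
  move: ut; rewrite quadratic_axis enorm_axis (gtr0_norm t0) /axis_coef eqxx; lra.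
apply: le_ereal_sup_tmp; exists (ereal_inf ((fun x => (ratio x)%:E) @` [set x | 0 < N x])).
  by exists [set x | 0 < N x] => //; exact: enorm_infty_gt.
apply: le_ereal_inf_tmp => _ [x /= Nx <-].
rewrite lee_fin /ratio ler_pdivlMr ?exprn_gt0//.
by apply: (le_trans (quadratic_ge x)); apply: le_trans (Pu x); have := C1; lra.
Qed.

Lemma solution_limsup :
  limf_esup (fun x => (u x / N x ^+ 2)%:E) (enorm_infty 3) = k2%:E.
Proof.
rewrite limf_esupE; apply/eqP; rewrite eq_le; apply/andP; split; last first.
  apply: le_ereal_inf_tmp => _ [A FA <-].
  have [t t0 At] := axis_in_nbhs_infty 1 FA.
  apply: le_ereal_sup_tmp; exists (ratio (t *: e 1))%:E; first by exists (t *: e 1).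
  by rewrite lee_fin; exact: (ratio_ge 1 t0).
apply/lee_addgt0Pr => d d0.
have FA := filterI (solution_near_quadratic d0) (enorm_infty_gt 0).
apply: ge_ereal_inf; eexists; first by eexists; [exact: FA|reflexivity].
apply: ge_ereal_sup => _ [x [/= ux Nx] <-].
rewrite -EFinD lee_fin ler_pdivrMr ?exprn_gt0//.
by have := quadratic_le x; lra.
Qed.

(** At equal distance [t] from [x0] along two different axes the values of [u]
    differ by [(k2 - k1) * t ^ 2] up to lower order. *)
Lemma solution_nonradial : nonradial u.
Proof.
move=> [x0 rad]; have dk : 0 < (k2 - k1) / 8 by have := k12; lra.
have [M _ MP] := solution_near_quadratic dk.
pose B := k2 * x0 0 1 - k1 * x0 0 0.
(* past this [t] the estimate [MP] applies and the quadratic term dominates *)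
pose t := `|M| + N x0 + 4 * `|B| / (k2 - k1) + 1.
have k0 : 0 < k2 - k1 by have := k12; lra.
have B0 : 0 <= 4 * `|B| / (k2 - k1) by rewrite divr_ge0 ?mulr_ge0// ltW.
have Nx0 := enorm_ge0 x0; have M0 := normr_ge0 M; have MM := ler_norm M.
have t0 : 0 < t by rewrite /t; lra.
have upr : u (t *: e 0 + x0) = u (t *: e 1 + x0).
  by apply: rad; rewrite !addrK !enorm_axis.
have Np : N (t *: e 0 + x0) <= 2 * t.
  apply: (le_trans (ler_enormD _ _)); rewrite enorm_axis gtr0_norm//.
  by rewrite /t; lra.
have MN : M < N (t *: e 0 + x0).
  have := ler_enormD (t *: e 0 + x0) (- x0); rewrite addrK enormN enorm_axis gtr0_norm//.
  by rewrite /t; lra.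
have h1 := MP _ MN; rewrite /= quadratic_step in h1.
have h2 := Pu (t *: e 1 + x0); rewrite quadratic_step -upr in h2.
have c0E : coef 0 = k1 by rewrite /axis_coef eqxx.
have c1E : coef 1 = k2 by [].
rewrite c0E in h1; rewrite c1E in h2.
have N2 : N (t *: e 0 + x0) ^+ 2 <= 4 * t ^+ 2.
  have -> : 4 * t ^+ 2 = (2 * t) ^+ 2 by ring.
  by rewrite lerXn2r ?nnegrE ?enorm_ge0//; lra.
have Bt : 4 * `|B| < (k2 - k1) * t.
  by rewrite -ltr_pdivrMl// mulrC /t; lra.
have BB : - `|B| <= B by rewrite lerNl -normrN ler_norm.
have C1' := C1.
have : (k2 - k1) * t ^+ 2 + 2 * t * B <= (k2 - k1) / 8 * (4 * t ^+ 2).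
  have := ler_wpM2l (ltW dk) N2; rewrite /B; lra.
have : 0 < t * ((k2 - k1) * t + 4 * B) by rewrite mulr_gt0//; lra.
lra.
Qed.

End properties.
End solution.

Theorem theorem1p2 (R : realType) (q : R) (hq : 1 < q)
    (kappa1 kappa2 : R) (hkappa1 : 0 < kappa1) (hkappa : kappa1 < kappa2) :
  exists u : 'rV[R]_3 -> R,
    [/\ entire_positive_solution q u,
        nonradial u,
        limf_einf (fun x => (u x / enorm x ^+ 2)%:E) (enorm_infty 3)
          = kappa1%:E &
        limf_esup (fun x => (u x / enorm x ^+ 2)%:E) (enorm_infty 3)
          = kappa2%:E].
Proof.
have [C [u [C1 cu Pu uE]]] := solution_exists hq hkappa1 hkappa.
exists u; split.
- exact: (solution_entire hq hkappa1 hkappa C1 cu Pu uE).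
- exact: (solution_nonradial hq hkappa1 hkappa C1 cu Pu uE).
- exact: (solution_liminf hq hkappa1 hkappa C1 cu Pu uE).
- exact: (solution_limsup hq hkappa1 hkappa C1 cu Pu uE).
Qed.
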